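(* Let $R$ be a basic right artinian $\mathbb{Z}$-graded ring, and let $N$ be a finitely generated right $R$-module. Let $P_N$ be the quotient of the pull-up $pN=\bigoplus_{i\in\mathbb{Z}}Ne_i$ by the submodule $\left(\bigoplus_{i<0}Ne_i\right)R$ generated by $\bigoplus_{i<0}Ne_i$. Then the Prüfer module $P_N$ has finite type if and only if $N$ is gradable.
   Context: A right artinian ring $R$ with Jacobson radical $J$ is basic if $R/J$ is a direct product of division rings. A graded right $R$-module is $M=\bigoplus_{n\in\mathbb{Z}}M_n$ with $M_iR_j\subseteq M_{i+j}$; a right $R$-module is gradable if it is isomorphic to the underlying $R$-module of some graded right $R$-module. For a right $R$-module $N$, $pN=\bigoplus_{n\in\mathbb{Z}}Ne_n$ is the graded right $R$-module with $(pN)_n=Ne_n$ a copy of $N$ ($e_n$ formal symbols) and action $(xe_n)r=(xr)e_{n+j}$ for $x\in N$, $r\in R_j$. A module $P$ is a Prüfer module if it has a locally nilpotent surjective endomorphism with nonzero kernel of finite length; for $N\neq0$, $P_N$ is a Prüfer module with respect to the endomorphism induced by the automorphism $xe_i\mapsto xe_{i-1}$ of $pN$. A module has finite type if it is isomorphic to a direct summand of a direct sum of (arbitrarily many) copies of $X$ for some finite length module $X$. *)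

(* Defs.v *)
From HB Require Import structures.
From mathcomp Require Import all_boot all_order all_algebra.
From mathcomp Require Import finmap.
From mathcomp Require Import boolp classical_sets functions cardinality fsbigop.

Set Implicit Arguments.
Unset Strict Implicit.
Unset Printing Implicit Defensive.

Import GRing.Theory.
Local Open Scope ring_scope.
Local Open Scope quotient_scope.

(* Rings are unital, not necessarily commutative, and possibly zero.  Right
   R-modules are left modules over the converse ring R^c, so that "x r" is
   written r *: x; the regular right module R_R is (R^c)^o.  Predicates being
   classical here ({pred M} is as good as set M), a submodule is a predicate S
   with submod_closed S. *)

Section DirectSum.
Variables (I : Type) (V : zmodType).

Definition finsupp_pred : {pred I -> V} :=
  fun f => `[< finite_set [set i | f i <> 0] >].

Record dsum := Dsum { dsum_fun :> I -> V; _ : dsum_fun \in finsupp_pred }.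

HB.instance Definition _ := [isSub for dsum_fun].
HB.instance Definition _ := [Choice of dsum by <:].

Lemma finsupp_predP (f : I -> V) :
  reflect (finite_set [set i | f i <> 0]) (f \in finsupp_pred).
Proof. exact: asboolP. Qed.

Lemma finsupp_zmod_closed : zmod_closed finsupp_pred.
Proof.
split; first by apply/finsupp_predP; rewrite (_ : mkset _ = set0)// -subset0.
move=> f g /finsupp_predP ff /finsupp_predP fg; apply/finsupp_predP.
apply: (@sub_finite_set _ _ ([set i | f i <> 0] `|` [set i | g i <> 0])%classic).
  move=> i /= h; apply: contrapT => /not_orP[/contrapT f0 /contrapT g0].
  by apply: h; transitivity (f i - g i) => //; rewrite f0 g0 subrr.
by rewrite finite_setU.
Qed.

HB.instance Definition _ := GRing.isZmodClosed.Build _ _ finsupp_zmod_closed.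
HB.instance Definition _ := [SubChoice_isSubZmodule of dsum by <:].

Lemma dsumP (f g : dsum) : (forall i, f i = g i) -> f = g.
Proof. by move=> fg; apply/val_inj/funext. Qed.

End DirectSum.

Section DirectSumModule.
Variables (I : Type) (A : pzRingType) (V : lmodType A).

Lemma finsupp_scaler_closed : scaler_closed (@finsupp_pred I V).
Proof.
move=> a f /finsupp_predP ff; apply/finsupp_predP.
apply: (sub_finite_set _ ff) => i /= + f0; apply.
by transitivity (a *: f i) => //; rewrite f0 scaler0.
Qed.

HB.instance Definition _ :=
  GRing.isScaleClosed.Build _ _ (@finsupp_pred I V) finsupp_scaler_closed.
HB.instance Definition _ := [SubZmodule_isSubLmodule of dsum I V by <:].

End DirectSumModule.

(* V is the internal direct sum of the additive subgroups G n. *)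
Definition internal_direct_sum (V : zmodType) (G : int -> {pred V}) : Prop :=
  (forall n, zmod_closed (G n)) /\
  forall x : V, exists! c : dsum int V,
    (forall n, c n \in G n) /\ x = \sum_(n \in [set: int]) c n.

Section Modules.
Variables (A : pzRingType) (M : lmodType A).

Definition artinian : Prop :=
  forall U : nat -> {pred M},
    (forall n, submod_closed (U n)) -> (forall n, {subset U n.+1 <= U n}) ->
  exists n, forall m, (n <= m)%N -> U m =i U n.

(* U is a maximal proper submodule of V, i.e. V / U is simple. *)
Definition maximal_in (U V : {pred M}) : Prop :=
  [/\ {subset U <= V}, ~ {subset V <= U} &
      forall W : {pred M}, submod_closed W ->
        {subset U <= W} -> {subset W <= V} -> W =i U \/ W =i V].

Definition finite_length : Prop :=
  exists (n : nat) (U : nat -> {pred M}),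
    [/\ forall i, submod_closed (U i), U 0%N =i pred1 0, U n =i predT &
        forall i, (i < n)%N -> maximal_in (U i) (U i.+1)].

Definition generated (S : {pred M}) : {pred M} :=
  fun x => `[< forall U : {pred M},
                 submod_closed U -> {subset S <= U} -> x \in U >].

Definition finitely_generated : Prop :=
  exists s : seq M, generated [in s] =i predT.

Definition direct_summand (U : {pred M}) : Prop :=
  submod_closed U /\
  exists V : {pred M},
    [/\ submod_closed V, forall x, x \in U -> x \in V -> x = 0 &
        forall x, exists u v, [/\ u \in U, v \in V & x = u + v]].

Lemma generatedP (S : {pred M}) x :
  reflect (forall U : {pred M}, submod_closed U -> {subset S <= U} -> x \in U)
          (x \in generated S).
Proof. exact: asboolP. Qed.

Lemma generated_submod_closed (S : {pred M}) : submod_closed (generated S).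
Proof.
split=> [|a x y /generatedP hx /generatedP hy]; apply/generatedP => U cU sU.
  by case: cU.
by case: (cU) => _; apply; [exact: hx|exact: hy].
Qed.

HB.instance Definition _ (S : {pred M}) :=
  GRing.isSubmodClosed.Build A M (generated S)
    (generated_submod_closed S).

End Modules.

Definition finite_type (A : pzRingType) (M : lmodType A) : Prop :=
  exists X : lmodType A, finite_length X /\
  exists (I : Type) (f : {linear M -> dsum I X}),
    injective f /\ direct_summand (fun y => `[< exists x, y = f x >]).

Section QuotientModule.
Variables (A : pzRingType) (M : lmodType A) (S : {pred M}).

Definition quotient_by := Quotient.quot (generated S).
HB.instance Definition _ := GRing.Zmodule.on quotient_by.
HB.instance Definition _ :
    ZmodQuotient M (Quotient.equiv (generated S)) 0 -%R +%R quotient_by :=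
  ZmodQuotient.on quotient_by.

Definition quotient_scale (a : A) (x : quotient_by) : quotient_by :=
  \pi_quotient_by (a *: repr x).

Lemma quotient_piP (x y : M) :
  reflect (\pi_quotient_by x = \pi_quotient_by y) (x - y \in generated S).
Proof. by rewrite Quotient.idealrBE; exact: eqP. Qed.

Lemma quotient_scaleE a (x : M) :
  quotient_scale a (\pi_quotient_by x) = \pi_quotient_by (a *: x).
Proof.
apply/quotient_piP; rewrite -scalerBr; apply: rpredZ.
by apply/quotient_piP; rewrite reprK.
Qed.

Fact quotient_pi_surj (x : quotient_by) : exists u : M, x = \pi_quotient_by u.
Proof. by exists (repr x); rewrite reprK. Qed.

Fact quotient_piD (x y : M) : \pi_quotient_by (x + y) = \pi x + \pi y.
Proof. exact: raddfD. Qed.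

Fact quotient_scalerA a b x :
  quotient_scale a (quotient_scale b x) = quotient_scale (a * b) x.
Proof.
by case: (quotient_pi_surj x) => u ->; rewrite !quotient_scaleE scalerA.
Qed.

Fact quotient_scale1r : left_id 1 quotient_scale.
Proof.
by move=> x; case: (quotient_pi_surj x) => u ->; rewrite quotient_scaleE scale1r.
Qed.

Fact quotient_scalerDr : right_distributive quotient_scale +%R.
Proof.
move=> a x y; case: (quotient_pi_surj x) (quotient_pi_surj y) => [u ->] [v ->].
by rewrite -quotient_piD !quotient_scaleE scalerDr quotient_piD.
Qed.

Fact quotient_scalerDl x : {morph quotient_scale^~ x : a b / a + b}.
Proof.
move=> a b; case: (quotient_pi_surj x) => u ->.
by rewrite !quotient_scaleE scalerDl quotient_piD.
Qed.

HB.instance Definition _ := GRing.Zmodule_isLmodule.Build A quotient_by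
  quotient_scalerA quotient_scale1r quotient_scalerDr quotient_scalerDl.

End QuotientModule.

Section Jacobson.
Variable R : pzRingType.

Definition right_artinian : Prop := artinian (R^c)^o.

Definition maximal_right_ideal (U : {pred (R^c)^o}) : Prop :=
  submod_closed U /\ maximal_in U predT.

Definition jacobson : {pred R} :=
  fun x => `[< forall U, maximal_right_ideal U -> (x : (R^c)^o) \in U >].

Lemma jacobsonP (x : R) :
  reflect (forall U, maximal_right_ideal U -> (x : (R^c)^o) \in U)
          (x \in jacobson).
Proof. exact: asboolP. Qed.

Lemma jacobson_zmod_closed : zmod_closed jacobson.
Proof.
split=> [|x y /jacobsonP Jx /jacobsonP Jy]; apply/jacobsonP => U maxU.
  by case: maxU => -[].
case: (maxU) => /GRing.submod_closedB[_ UB] _.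
by apply: UB; [exact: Jx|exact: Jy].
Qed.
HB.instance Definition _ := GRing.isZmodClosed.Build R jacobson
  jacobson_zmod_closed.

Lemma right_idealM (U : {pred (R^c)^o}) (x r : R) :
  submod_closed U -> (x : (R^c)^o) \in U -> ((x * r : R) : (R^c)^o) \in U.
Proof.
by move=> /GRing.submod_closed_semi[_ UZ] xU; exact: (UZ (r : R^c) _ xU).
Qed.

Lemma jacobsonMr (x r : R) : x \in jacobson -> x * r \in jacobson.
Proof.
move=> /jacobsonP Jx; apply/jacobsonP => U maxU.
by apply: right_idealM; [case: maxU|exact: Jx].
Qed.

(* If r is not in the maximal right ideal U, then {y | r y \in U} is again a
   maximal right ideal. *)
Lemma jacobsonMl (r x : R) : x \in jacobson -> r * x \in jacobson.
Proof.
move=> /jacobsonP Jx; apply/jacobsonP => U [cU [_ Upr Umax]].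
have [rU|rNU] := boolP ((r : (R^c)^o) \in U); first exact: right_idealM.
have [U0 UL] := cU.
have UD u v : u \in U -> v \in U -> u + v \in U.
  by move=> uU vU; rewrite -[u]scale1r; exact: UL.
have UB := (GRing.submod_closedB cU).2.
pose K : {pred (R^c)^o} := fun y => (r * y : R) \in U.
suff maxK : maximal_right_ideal K by exact: (Jx _ maxK).
have cK : submod_closed K.
  split=> [|a y z yK zK]; first by rewrite unfold_in mulr0.
  rewrite unfold_in.
  have -> : r * (a *: y + z : R) =
      (a : R^c) *: ((r * y : R) : (R^c)^o) + ((r * z : R) : (R^c)^o) :> R.
    by rewrite mulrDr; congr (_ + _); exact: (mulrA r (y : R) (a : R)).
  exact: UL.
split=> //; split=> // [/(_ (1 : R) isT)|W cW KW _].
  by rewrite unfold_in mulr1 (negbTE rNU).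
have [[k kW kNK]|noK] := pselect (exists2 k : (R^c)^o, k \in W & k \notin K);
    last first.
  left=> k; apply/idP/idP => [kW|]; last exact: KW.
  by apply/negPn/negP => kNK; apply: noK; exists k.
right=> y; rewrite [RHS]inE.
have WD u v : u \in W -> v \in W -> u + v \in W.
  by case: cW => _ WL uW vW; rewrite -[u]scale1r; exact: WL.
suff W1 : ((1 : R) : (R^c)^o) \in W.
  by rewrite -[y](mul1r (y : R)); exact: right_idealM.
pose V : {pred (R^c)^o} := fun z => `[< exists a u : R,
  (u : (R^c)^o) \in U /\ z = r * k * a + u :> R >].
have cV : submod_closed V.
  split; first by apply/asboolP; exists 0, 0; rewrite mulr0 addr0.
  move=> a _ _ /asboolP[b [u [uU ->]]] /asboolP[c [v [vU ->]]].
  apply/asboolP; exists (b * a + c), (u * a + v); split.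
    by apply: UD => //; exact: right_idealM.
  rewrite mulrDr -addrA (addrCA (r * k * c)) addrA mulrA.
  by congr (_ + _); exact: mulrDl.
have [||VU|VT] := Umax V cV.
- by move=> u uU; apply/asboolP; exists 0, u; rewrite mulr0 add0r.
- by [].
- have : r * k \in V by apply/asboolP; exists 1, 0; rewrite mulr1 addr0.
  by rewrite VU => rkU; rewrite unfold_in rkU in kNK.
have /asboolP[a [u [uU ru]]] : (r : (R^c)^o) \in V by rewrite VT.
pose ka : R := (k : R) * a.
rewrite -[1 : R](subrK ka); apply: WD; last exact: right_idealM.
apply: KW; rewrite unfold_in (_ : r * (1 - ka) = u) //.
by rewrite mulrBr mulr1 {1}ru /ka mulrA addrAC subrr add0r.
Qed.

Definition radical_quotient := Quotient.quot jacobson.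
HB.instance Definition _ := GRing.Zmodule.on radical_quotient.
HB.instance Definition _ :
    ZmodQuotient R (Quotient.equiv jacobson) 0 -%R +%R radical_quotient :=
  ZmodQuotient.on radical_quotient.

Definition radical_quotient_one : radical_quotient := \pi 1.
Definition radical_quotient_mul (x y : radical_quotient) : radical_quotient :=
  \pi_radical_quotient (repr x * repr y).

Lemma radical_quotient_piP (x y : R) :
  reflect (\pi_radical_quotient x = \pi_radical_quotient y)
          (x - y \in jacobson).
Proof. by rewrite Quotient.idealrBE; exact: eqP. Qed.

Lemma radical_quotient_mulE (x y : R) :
  radical_quotient_mul (\pi_radical_quotient x) (\pi_radical_quotient y) =
  \pi_radical_quotient (x * y).
Proof.
apply/radical_quotient_piP.
set x' := repr _; set y' := repr _.
have -> : x' * y' - x * y = (x' - x) * y' + x * (y' - y).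
  by rewrite mulrBl mulrBr addrA subrK.
apply: rpredD; [apply: jacobsonMr|apply: jacobsonMl];
  by apply/radical_quotient_piP; rewrite reprK.
Qed.

Fact radical_quotient_pi_surj (x : radical_quotient) :
  exists u : R, x = \pi_radical_quotient u.
Proof. by exists (repr x); rewrite reprK. Qed.

Fact radical_quotient_piD (x y : R) :
  \pi_radical_quotient (x + y) = \pi x + \pi y.
Proof. exact: raddfD. Qed.

Fact radical_quotient_mulA : associative radical_quotient_mul.
Proof.
move=> x y z.
case: (radical_quotient_pi_surj x) (radical_quotient_pi_surj y)
  (radical_quotient_pi_surj z) => [u ->] [v ->] [w ->].
by rewrite !radical_quotient_mulE mulrA.
Qed.

Fact radical_quotient_mul1r : left_id radical_quotient_one radical_quotient_mul.
Proof.
move=> x; case: (radical_quotient_pi_surj x) => u ->.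
by rewrite radical_quotient_mulE mul1r.
Qed.

Fact radical_quotient_mulr1 : right_id radical_quotient_one radical_quotient_mul.
Proof.
move=> x; case: (radical_quotient_pi_surj x) => u ->.
by rewrite radical_quotient_mulE mulr1.
Qed.

Fact radical_quotient_mulDl : left_distributive radical_quotient_mul +%R.
Proof.
move=> x y z.
case: (radical_quotient_pi_surj x) (radical_quotient_pi_surj y)
  (radical_quotient_pi_surj z) => [u ->] [v ->] [w ->].
rewrite -radical_quotient_piD !radical_quotient_mulE mulrDl.
exact: radical_quotient_piD.
Qed.

Fact radical_quotient_mulDr : right_distributive radical_quotient_mul +%R.
Proof.
move=> x y z.
case: (radical_quotient_pi_surj x) (radical_quotient_pi_surj y)
  (radical_quotient_pi_surj z) => [u ->] [v ->] [w ->].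
rewrite -radical_quotient_piD !radical_quotient_mulE mulrDr.
exact: radical_quotient_piD.
Qed.

HB.instance Definition _ := GRing.Zmodule_isPzRing.Build radical_quotient
  radical_quotient_mulA radical_quotient_mul1r radical_quotient_mulr1
  radical_quotient_mulDl radical_quotient_mulDr.

End Jacobson.

Definition division_ring (D : pzRingType) : Prop :=
  (1 : D) <> 0 /\ forall x : D, x <> 0 -> exists y, x * y = 1 /\ y * x = 1.

(* A ring isomorphism from R / J to the product of the D i is given by its
   components f i. *)
Definition basic (R : pzRingType) : Prop :=
  exists (I : Type) (D : I -> pzRingType),
    (forall i, division_ring (D i)) /\
    exists f : forall i, {rmorphism radical_quotient R -> D i},
      bijective (fun x i => f i x).

Record grading (R : pzRingType) := Grading {
  homog :> int -> {pred R};
  homog_sum : internal_direct_sum homog;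
  homogM : forall i j x y,
    x \in homog i -> y \in homog j -> x * y \in homog (i + j) }.

Section Graded.
Variables (R : pzRingType) (g : grading R).

Definition module_grading (M : lmodType R^c) (G : int -> {pred M}) : Prop :=
  internal_direct_sum G /\
  forall i j (x : M) (r : R),
    x \in G i -> r \in g j -> (r : R^c) *: x \in G (i + j).

Definition gradable (N : lmodType R^c) : Prop :=
  exists (M : lmodType R^c) (G : int -> {pred M}),
    module_grading G /\ exists f : {linear M -> N}, bijective f.

End Graded.

Section FiniteSums.
Variable V : zmodType.
Implicit Types F G : int -> V.

Local Notation finsupp F := (finite_set [set i | F i <> 0]).

Fact fset_supp F : finsupp F ->
  exists B : {fset int}, forall i, i \notin B -> F i = 0.
Proof.
move=> finF; exists (fset_set [set i | F i <> 0]) => i.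
by rewrite in_fset_set// notin_setE /= => /contrapT.
Qed.

Lemma fsumD F G : finsupp F -> finsupp G ->
  \sum_(i \in [set: int]) (F i + G i) =
  \sum_(i \in [set: int]) F i + \sum_(i \in [set: int]) G i.
Proof.
move=> /fset_supp[B BF] /fset_supp[C CG].
have B0 i : i \notin (B `|` C)%fset -> F i = 0.
  by rewrite in_fsetU negb_or => /andP[/BF].
have C0 i : i \notin (B `|` C)%fset -> G i = 0.
  by rewrite in_fsetU negb_or => /andP[_ /CG].
rewrite !(@fsbigTE _ _ _ _ (B `|` C)%fset) ?big_split// => i iBC.
by rewrite B0// C0// addr0.
Qed.

Lemma fsum_only F n : (forall i, i != n -> F i = 0) ->
  \sum_(i \in [set: int]) F i = F n.
Proof.
move=> F0; rewrite (@fsbigTE _ _ _ _ [fset n]%fset) ?big_seq_fset1// => i.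
by rewrite in_fset1; exact: F0.
Qed.

Lemma fsum_ind (P : V -> Prop) F : finsupp F ->
  P 0 -> (forall x y, P x -> P y -> P (x + y)) -> (forall i, P (F i)) ->
  P (\sum_(i \in [set: int]) F i).
Proof.
move=> /fset_supp[B BF] P0 PD PF; rewrite (@fsbigTE _ _ _ _ B)//.
exact: big_ind.
Qed.

Lemma dsum_finite (c : dsum int V) : finsupp c.
Proof. exact/finsupp_predP/valP. Qed.

Fact single_subproof (n : int) (x : V) :
  (fun i : int => if i == n then x else 0) \in @finsupp_pred int V.
Proof.
apply/finsupp_predP; apply: (@sub_finite_set _ _ [set n]%classic) => //.
by move=> i /=; case: eqP.
Qed.

(* The element x e_n of the direct sum. *)
Definition single (n : int) (x : V) : dsum int V := Dsum (single_subproof n x).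

End FiniteSums.

Section Component.
Variables (R : pzRingType) (g : grading R).
Implicit Types r s : R.

Definition component r : dsum int R := sval (cid ((homog_sum g).2 r)).

Lemma component_homog r n : component r n \in g n.
Proof. by rewrite /component; case: cid => c /= [[]]. Qed.

Lemma component_sum r : r = \sum_(n \in [set: int]) component r n.
Proof. by rewrite /component; case: cid => c /= [[]]. Qed.

Lemma component_uniq r (c : dsum int R) :
  (forall n, c n \in g n) -> r = \sum_(n \in [set: int]) c n ->
  component r = c.
Proof.
by move=> cg rc; rewrite /component; case: cid => d /= [_]; exact.
Qed.

Lemma componentD r s n : component (r + s) n = component r n + component s n.
Proof.
suff -> : component (r + s) = component r + component s by [].
apply: component_uniq => [m|].
  have [/(_ m) gm _] := homog_sum g.
  by apply: (GRing.zmod_closedD gm).2; exact: component_homog.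
by rewrite fsumD -?component_sum//; exact: dsum_finite.
Qed.

Lemma component_id r k n : r \in g k ->
  component r n = if n == k then r else 0.
Proof.
move=> rk; rewrite (@component_uniq r (single k r))//= => [m|].
  case: eqP => [->//|_].
  by have [/(_ m)[]] := homog_sum g.
by rewrite (@fsum_only _ _ k) ?eqxx// => i /negbTE ->.
Qed.

Lemma component0 n : component 0 n = 0.
Proof.
have g0 : 0 \in g 0 by have [/(_ 0)[]] := homog_sum g.
by rewrite (component_id _ g0); case: ifP.
Qed.

Lemma homog_ind (P : R -> Prop) :
  P 0 -> (forall r s, P r -> P s -> P (r + s)) ->
  (forall n r, r \in g n -> P r) -> forall r, P r.
Proof.
move=> P0 PD Pg r; rewrite (component_sum r).
apply: fsum_ind => // [|i]; first exact: dsum_finite.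
by apply: (Pg i); exact: component_homog.
Qed.

Lemma homog1 : 1 \in g 0.
Proof.
have h j x r : x \in g j -> component (x * r) j = x * component r 0.
  move=> xj; elim/homog_ind: r => [|r s IHr IHs|k r rk].
  - by rewrite mulr0 !component0 mulr0.
  - by rewrite mulrDr !componentD IHr IHs mulrDr.
  - rewrite (component_id _ (homogM xj rk)) (component_id _ rk).
    rewrite -[X in X == _]addr0 (inj_eq (addrI j)).
    by case: eqP; rewrite ?mulr0.
have e1 r : r = r * component 1 0.
  elim/homog_ind: r => [|r s IHr IHs|k r rk].
  - by rewrite mul0r.
  - by rewrite mulrDl -IHr -IHs.
  - by rewrite -(h _ _ _ rk) mulr1 (component_id _ rk) eqxx.
by rewrite [X in X \in _]e1 mul1r; exact: component_homog.
Qed.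

End Component.

(* The action depends on g, hence the phantom argument. *)
Definition pullup (R : pzRingType) (g : grading R) (N : lmodType R^c) : Type :=
  dsum int N.
HB.instance Definition _ (R : pzRingType) (g : grading R) (N : lmodType R^c) :=
  GRing.Zmodule.on (pullup g N).

Section PullUp.
Variables (R : pzRingType) (g : grading R) (N : lmodType R^c).
Implicit Types (r s : R) (f : int -> N).

(* The additive extension of (x e_n) r = (x r) e_(n + j), r homogeneous of
   degree j: the e_m-coordinate of (\sum_n x_n e_n) r is
   \sum_j x_(m - j) r_j.  See pullup_singleE below. *)
Definition pullup_fun r f (m : int) : N :=
  \sum_(j \in [set: int]) (component g r j : R^c) *: f (m - j).

Fact pullup_summand_finite r f m :
  finite_set [set j | (component g r j : R^c) *: f (m - j) <> 0].
Proof.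
apply: (sub_finite_set _ (dsum_finite (component g r))) => j /= + r0.
by rewrite r0 scale0r.
Qed.

Lemma pullup_fun_homog r k f m : r \in g k ->
  pullup_fun r f m = (r : R^c) *: f (m - k).
Proof.
move=> rk; rewrite /pullup_fun (@fsum_only _ _ k) ?(component_id _ rk) ?eqxx//.
by move=> i /negbTE ik; rewrite (component_id _ rk) ik scale0r.
Qed.

Lemma pullup_funDl r s f m :
  pullup_fun (r + s) f m = pullup_fun r f m + pullup_fun s f m.
Proof.
rewrite -fsumD; [|exact: pullup_summand_finite..]; apply: eq_fsbigr => j _.
by rewrite componentD -scalerDl.
Qed.

Lemma pullup_funDr r f h m :
  pullup_fun r (fun i => f i + h i) m = pullup_fun r f m + pullup_fun r h m.
Proof.
rewrite -fsumD; [|exact: pullup_summand_finite..].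
by apply: eq_fsbigr => j _; rewrite -scalerDr.
Qed.

Lemma pullup_fun0l f m : pullup_fun 0 f m = 0.
Proof. by apply: fsbig1 => j _; rewrite component0 scale0r. Qed.

Lemma pullup_fun0r r m : pullup_fun r (fun=> 0) m = 0.
Proof. by apply: fsbig1 => j _; rewrite scaler0. Qed.

Lemma pullup_fun1 f m : pullup_fun 1 f m = f m.
Proof. by rewrite (pullup_fun_homog _ _ (homog1 g)) subr0 scale1r. Qed.

Lemma pullup_funA r s f m :
  pullup_fun s (pullup_fun r f) m = pullup_fun (r * s) f m.
Proof.
elim/(homog_ind (g := g)): s => [|s s' IHs IHs'|k s sk].
- by rewrite mulr0 !pullup_fun0l.
- by rewrite mulrDr !pullup_funDl IHs IHs'.
rewrite (pullup_fun_homog _ _ sk).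
elim/(homog_ind (g := g)): r => [|r r' IHr IHr'|j r rj].
- by rewrite mul0r !pullup_fun0l scaler0.
- by rewrite mulrDl !pullup_funDl scalerDr IHr IHr'.
rewrite (pullup_fun_homog _ _ rj) (pullup_fun_homog _ _ (homogM rj sk)).
by rewrite scalerA addrAC opprD addrA.
Qed.

Lemma pullup_fun_finsupp r (f : dsum int N) :
  pullup_fun r f \in @finsupp_pred int N.
Proof.
elim/(homog_ind (g := g)): r => [|r s IHr IHs|k r rk].
- rewrite (_ : pullup_fun 0 f = 0) ?rpred0//.
  by apply/funext => m; exact: pullup_fun0l.
- rewrite (_ : pullup_fun (r + s) f = pullup_fun r f + pullup_fun s f).
    exact: rpredD.
  by apply/funext => m; exact: pullup_funDl.
apply/finsupp_predP.
apply: (sub_finite_set _ (finite_image (fun i => i + k) (dsum_finite f))).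
move=> m /=; rewrite (pullup_fun_homog _ _ rk) => fm.
by exists (m - k); [move=> f0; apply: fm; rewrite f0 scaler0|rewrite subrK].
Qed.

Local Notation pullup := (pullup g N).

Definition pullup_scale (r : R^c) (f : pullup) : pullup :=
  Dsum (pullup_fun_finsupp r f).

Fact pullup_scalerA (r s : R^c) (u : pullup) :
  pullup_scale r (pullup_scale s u) = pullup_scale (r * s) u.
Proof. by apply: dsumP => m; exact: pullup_funA. Qed.

Fact pullup_scale1r : left_id 1 pullup_scale.
Proof. by move=> f; apply: dsumP => m; exact: pullup_fun1. Qed.

Fact pullup_scalerDr : right_distributive pullup_scale +%R.
Proof. by move=> r f h; apply: dsumP => m; exact: pullup_funDr. Qed.

Fact pullup_scalerDl (u : pullup) : {morph pullup_scale^~ u : r s / r + s}.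
Proof. by move=> r s; apply: dsumP => m; exact: pullup_funDl. Qed.

HB.instance Definition _ := GRing.Zmodule_isLmodule.Build R^c pullup
  pullup_scalerA pullup_scale1r pullup_scalerDr pullup_scalerDl.

Lemma pullup_singleE r j (n : int) (x : N) : r \in g j ->
  (r : R^c) *: (single n x : pullup) =
  single (n + j) ((r : R^c) *: x) :> pullup.
Proof.
move=> rj; apply: dsumP => m.
transitivity (pullup_fun r (single n x) m) => //.
rewrite (pullup_fun_homog _ _ rj) /= subr_eq.
by case: ifP; rewrite ?scaler0.
Qed.

(* The additive subgroup \bigoplus_(i < 0) N e_i. *)
Definition pullup_neg : {pred pullup} :=
  fun u => `[< forall i : int, 0 <= i -> u i = 0 >].

(* The module P_N.  For N = 0 it is the zero module. *)
Definition pruefer : lmodType R^c := quotient_by pullup_neg.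

End PullUp.

(* Main.v *)
From HB Require Import structures.
Require Import Defs.
From mathcomp Require Import all_boot all_order all_algebra.
From mathcomp Require Import finmap.
From mathcomp Require Import boolp classical_sets cardinality fsbigop.
From mathcomp Require Import zify.

Set Implicit Arguments.
Unset Strict Implicit.
Unset Printing Implicit Defensive.

Import Order.TTheory GRing.Theory Num.Theory.
Local Open Scope ring_scope.
Local Open Scope quotient_scope.
Local Open Scope classical_set_scope.

(** Write [pN] for the pull-up and [P] for its quotient, the Pruefer module.

    If [N] is graded by components [N_m], then [pN] is, for each integer [k],
    the sum of a copy of [N], namely the span of the [N_(n + k) e_n].  The
    relations defining [P] respect this decomposition, and [P] becomes the
    direct sum of the quotients of [N] by the submodules generated by the [N_m]
    with [m < k].  As [N] has finite length, these submodules are constant for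
    small and for large [k]; so only finitely many quotients occur, and [P] has
    finite type ([graded_pruefer_finite_type]).

    Conversely let [P] be a direct summand of a sum of copies of a module of
    finite length.  A right artinian basic graded ring [R] has finite length and
    lives in finitely many degrees, because its homogeneous elements of nonzero
    degree are nilpotent, hence, the ring being basic, lie in the radical
    ([grading_finite_support]).  So [N] has finite length over the degree zero
    part of [R], and the parts of [pN] and [P] in finitely many degrees have
    finite length too.

    First, [P] has a nonzero graded direct summand that lives in finitely many
    degrees, all as large as required ([high_summand]).  In high degrees [P]
    agrees with [pN], so this is a graded direct summand [Z] of [pN]
    ([lift_summand]), and [Z] may be taken indecomposable.

    Secondly, the inclusion of [Z] and the projection onto [Z] correspond to
    ungraded maps [Z -> N] and [N -> Z].  Their composition is the sum, over the
    powers of the shift of [pN], of homogeneous endomorphisms of [Z], the one of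
    degree zero being the identity.  The others are nilpotent since [Z] is
    bounded; since it is also indecomposable, the homogeneous nilpotent
    endomorphisms of [Z] form a semigroup, which is nilpotent by Levitzki's
    theorem ([levitzki]).  Hence the composition is bijective, and [Z] is a
    direct summand of [N] ([summand_of_pullup]).

    Splitting off such summands one after the other, always with respect to the
    complement of what has been obtained before, exhausts [N]
    ([pruefer_finite_type_graded]).

    Summands are handled through their idempotents, and finite length through
    rank functions on lattices of substructures ([finlen]). *)

(** * Linear maps, sub-structures over a set of scalars, and ranks *)

Lemma nat_min (T : Type) (F : T -> Prop) (rho : T -> nat) :
  (exists t, F t) -> exists t, F t /\ forall t', F t' -> (rho t <= rho t')%N.
Proof.
move=> [t0 Ft0].
have exn : exists n, `[< exists2 t, F t & rho t = n >].
  by exists (rho t0); apply/asboolP; exists t0.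
case: (ex_minnP exn) => n /asboolP[t Ft <-] tmin; exists t; split=> // t' Ft'.
by apply: tmin; apply/asboolP; exists t'.
Qed.

Lemma nat_max (T : Type) (F : T -> Prop) (rho : T -> nat) (n : nat) :
  (exists t, F t) -> (forall t, F t -> (rho t <= n)%N) ->
  exists t, F t /\ forall t', F t' -> (rho t' <= rho t)%N.
Proof.
move=> exF rhon.
have [t [Ft tmin]] := nat_min (fun t => n - rho t)%N exF.
exists t; split=> // t' Ft'.
have := tmin _ Ft'; have := rhon _ Ft; have := rhon _ Ft'; lia.
Qed.

Section Linear.
Variables (A : pzRingType).

(** Maps obtained by choice come as plain functions; so additivity and linearity
    are properties here. *)
Definition additive_map (U V : zmodType) (f : U -> V) :=
  forall x y, f (x + y) = f x + f y.

Definition lin (U V : lmodType A) (f : U -> V) :=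
  additive_map f /\ forall a x, f (a *: x) = a *: f x.

Lemma add0f (U V : zmodType) (f : U -> V) : additive_map f -> f 0 = 0.
Proof. by move=> fD; apply: (addrI (f 0)); rewrite -fD !addr0. Qed.

Lemma addNf (U V : zmodType) (f : U -> V) x :
  additive_map f -> f (- x) = - f x.
Proof.
by move=> fD; apply: (addrI (f x)); rewrite -fD !subrr (add0f fD).
Qed.

Lemma addBf (U V : zmodType) (f : U -> V) x y :
  additive_map f -> f (x - y) = f x - f y.
Proof. by move=> fD; rewrite fD (addNf _ fD). Qed.

Lemma add_sumf (U V : zmodType) (f : U -> V) (n : nat) (F : 'I_n -> U) :
  additive_map f -> f (\sum_(i < n) F i) = \sum_(i < n) f (F i).
Proof. by move=> fD; apply: (big_morph f fD (add0f fD)). Qed.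

Lemma lin_linear (U V : lmodType A) (f : {linear U -> V}) : lin f.
Proof. by split=> [x y|a x]; [exact: linearD|exact: linearZ]. Qed.

Lemma lin_comp (U V W : lmodType A) (f : V -> W) (h : U -> V) :
  lin f -> lin h -> lin (f \o h).
Proof.
by move=> [fD fZ] [hD hZ]; split=> [x y|a x] /=; rewrite ?hD ?fD ?hZ ?fZ.
Qed.

Lemma lin_sub (U V : lmodType A) (f h : U -> V) :
  lin f -> lin h -> lin (fun x => f x - h x).
Proof.
move=> [fD fZ] [hD hZ]; split=> [x y|a x].
  by rewrite fD hD opprD addrACA.
by rewrite fZ hZ scalerBr.
Qed.

Lemma lin_add (U V : lmodType A) (f h : U -> V) :
  lin f -> lin h -> lin (fun x => f x + h x).
Proof.
move=> [fD fZ] [hD hZ]; split=> [x y|a x].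
  by rewrite fD hD addrACA.
by rewrite fZ hZ scalerDr.
Qed.

Lemma lin_iter (U : lmodType A) (f : U -> U) k : lin f -> lin (iter k f).
Proof. by move=> lf; elim: k => [|k IH] //; apply: lin_comp lf IH. Qed.

End Linear.

Section Rank.
Variables (A : pzRingType) (K : {pred A}).

(** Only the scalars of [K] need to act on [U]: with [K] the whole ring these
    are the submodules, with [K] the degree zero part of a grading they are the
    substructures to which the homogeneous components belong. *)
Definition ksub (V : lmodType A) (U : set V) :=
  [/\ U 0, forall x y, U x -> U y -> U (x - y) &
      forall a x, a \in K -> U x -> U (a *: x)].

Definition klin (V W : lmodType A) (f : V -> W) :=
  additive_map f /\ forall a x, a \in K -> f (a *: x) = a *: f x.

(** Finite length of the interval from [B] to [W], in the form in which it is
    used: a bounded strictly monotone rank gives at once minimal and maximal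
    elements of families of substructures, and ranks of pieces can simply be
    added. *)
Definition finlen (V : lmodType A) (B W : set V) :=
  exists (rho : set V -> nat) (n : nat), forall U U',
    ksub U -> ksub U' -> B `<=` U -> U `<=` U' -> U' `<=` W ->
  [/\ (rho U <= rho U')%N, (rho U' <= n)%N &
      (rho U' <= rho U)%N -> U' `<=` U].

Section Ksub.
Variables (V : lmodType A).
Implicit Types (U B W : set V).

Lemma ksubN U x : ksub U -> U x -> U (- x).
Proof. by move=> [U0 UB _] Ux; rewrite -sub0r; exact: UB. Qed.

Lemma ksubD U x y : ksub U -> U x -> U y -> U (x + y).
Proof.
by move=> kU Ux Uy; rewrite -[y]opprK; case: (kU) => _ UB _; apply: (UB) => //;
  exact: ksubN.
Qed.

Lemma ksub_sum U n (F : 'I_n -> V) :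
  ksub U -> (forall i, U (F i)) -> U (\sum_(i < n) F i).
Proof.
move=> kU UF; apply: big_ind => //; first by case: kU.
by move=> x y; exact: ksubD.
Qed.

Lemma ksub0 : ksub [set 0 : V].
Proof.
by split=> // [x y -> ->|a x _ ->]; rewrite /= ?subr0 ?scaler0.
Qed.

Lemma ksubT : ksub [set: V].
Proof. by []. Qed.

Lemma ksubI U W : ksub U -> ksub W -> ksub (U `&` W).
Proof.
move=> [U0 UB UZ] [W0 WB WZ]; split=> //.
  by move=> x y [Ux Wx] [Uy Wy]; split; [exact: UB|exact: WB].
by move=> a x aK [Ux Wx]; split; [exact: UZ|exact: WZ].
Qed.

Definition sumset U W : set V := [set x | exists2 u, U u & W (x - u)].

Lemma sumsetl U W : ksub W -> U `<=` sumset U W.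
Proof. by move=> [W0 _ _] x Ux; exists x => //; rewrite subrr. Qed.

Lemma sumsetr U W : ksub U -> W `<=` sumset U W.
Proof. by move=> [U0 _ _] x Wx; exists 0; rewrite ?subr0. Qed.

Lemma sumset_sub U W X : ksub X -> U `<=` X -> W `<=` X -> sumset U W `<=` X.
Proof.
move=> kX UX WX x [u /UX Xu /WX Xxu].
by rewrite -[x](subrK u); exact: ksubD.
Qed.

Lemma ksub_sumset U W : ksub U -> ksub W -> ksub (sumset U W).
Proof.
move=> [U0 UB UZ] [W0 WB WZ]; split.
- by exists 0; rewrite ?subr0.
- move=> x y [u Uu Wu] [v Uv Wv]; exists (u - v); first exact: UB.
  have -> : x - y - (u - v) = (x - u) - (y - v).
    by rewrite !opprB addrACA [RHS]addrACA [- y - u]addrC.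
  exact: WB.
- move=> a x aK [u Uu Wu]; exists (a *: u); first exact: UZ.
  by rewrite -scalerBr; exact: WZ.
Qed.

Lemma finlen_sub B B' W W' :
  B `<=` B' -> W' `<=` W -> finlen B W -> finlen B' W'.
Proof.
move=> BB' W'W [rho [n rhoP]]; exists rho, n => U U' kU kU' BU UU' UW.
by apply: rhoP => //; [exact: subset_trans BU|exact: subset_trans W'W].
Qed.

(** Additivity along [C]: a substructure is determined, among those comparable
    with it, by its intersection and its sum with [C] (the modular law). *)
Lemma finlen_trans B C W : ksub C -> ksub W ->
  B `<=` C -> C `<=` W -> finlen B C -> finlen C W -> finlen B W.
Proof.
move=> kC kW BC CW [r1 [n1 r1P]] [r2 [n2 r2P]].
exists (fun U => r1 (U `&` C) + r2 (sumset U C))%N, (n1 + n2)%N.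
move=> U U' kU kU' BU UU' UW.
have [|||||r1le r1n r1eq] := r1P (U `&` C) (U' `&` C).
- exact: ksubI.
- exact: ksubI.
- by move=> x Bx; split; [exact: BU|exact: BC].
- by move=> x [/UU' ? ?].
- by move=> x [].
have [|||||r2le r2n r2eq] := r2P (sumset U C) (sumset U' C).
- exact: ksub_sumset.
- exact: ksub_sumset.
- exact: sumsetr.
- by move=> x [u /UU' ? ?]; exists u.
- exact: sumset_sub.
split; [exact: leq_add|exact: leq_add|move=> rle x U'x].
have /r1eq sub1 : (r1 (U' `&` C) <= r1 (U `&` C))%N by lia.
have /r2eq sub2 : (r2 (sumset U' C) <= r2 (sumset U C))%N by lia.
have [u Uu Cu] := sub2 _ (sumsetl kC U'x).
rewrite -[x](subrK u); apply: ksubD => //.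
apply: (proj1 (sub1 _ _)); split=> //.
by case: kU' => _ U'B _; apply: U'B => //; exact: UU'.
Qed.

Lemma finlen_sum U W : ksub U -> ksub W ->
  finlen [set 0] U -> finlen [set 0] W -> finlen [set 0] (sumset U W).
Proof.
move=> kU kW flU [r [n rP]].
apply: (finlen_trans kU) => //; first exact: ksub_sumset.
- by move=> _ ->; case: kU.
- exact: sumsetl.
exists (fun X => r (X `&` W)), n => X X' kX kX' UX XX' X'UW.
have [|||||rle rn req] := rP (X `&` W) (X' `&` W).
- exact: ksubI.
- exact: ksubI.
- by move=> _ ->; split; [case: kX|case: kW].
- by move=> x [/XX' ? ?].
- by move=> x [].
split=> // /req sub x X'x; have [u Uu Wxu] := X'UW _ X'x.
rewrite -[x](subrK u); apply: ksubD => //; last exact: UX.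
apply: (proj1 (sub _ _)); split=> //.
by case: kX' => _ X'B _; apply: X'B => //; apply: XX'; exact: UX.
Qed.

End Ksub.

Lemma ksub_preim (V W : lmodType A) (f : V -> W) (U : set W) :
  klin f -> ksub U -> ksub [set x | U (f x)].
Proof.
move=> [fD fZ] [U0 UB UZ]; split=> [|x y Ux Uy|a x aK Ux] /=.
- by rewrite (add0f fD).
- by rewrite (addBf _ _ fD); exact: UB.
- by rewrite fZ//; exact: UZ.
Qed.

Lemma ksub_image (V W : lmodType A) (f : V -> W) (U : set V) :
  klin f -> ksub U -> ksub [set y | exists2 x, U x & y = f x].
Proof.
move=> [fD fZ] [U0 UB UZ]; split=> [|_ _ [x Ux ->] [y Uy ->]|a _ aK [x Ux ->]].
- by exists 0; rewrite ?(add0f fD).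
- by exists (x - y); [exact: UB|rewrite (addBf _ _ fD)].
- by exists (a *: x); [exact: UZ|rewrite fZ].
Qed.

Lemma finlen_image (V W : lmodType A) (f : V -> W) (U : set V) (U' : set W) :
  klin f -> ksub U -> (forall y, U' y -> exists2 x, U x & y = f x) ->
  finlen [set 0] U -> finlen [set 0] U'.
Proof.
move=> lf kU fU [r [n rP]].
exists (fun X => r (U `&` [set x | X (f x)])), n => X X' kX kX' _ XX' X'U'.
have [|||||rle rn req] :=
    rP (U `&` [set x | X (f x)]) (U `&` [set x | X' (f x)]).
- by apply: ksubI => //; exact: ksub_preim.
- by apply: ksubI => //; exact: ksub_preim.
- by move=> _ ->; split; [case: kU|case: (ksub_preim lf kX)].
- by move=> x [? /XX'].
- by move=> x [].
split=> // /req sub y X'y; have [x Ux yx] := fU _ (X'U' _ X'y).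
by move: X'y; rewrite yx => X'y; have [] := sub x (conj Ux X'y).
Qed.

End Rank.

Lemma ksub_weak (A : pzRingType) (K K' : {pred A}) (V : lmodType A)
  (U : set V) : {subset K' <= K} -> ksub K U -> ksub K' U.
Proof. by move=> KK' [U0 UB UZ]; split=> // a x /KK'; exact: UZ. Qed.

Lemma finlen_weak (A : pzRingType) (K K' : {pred A}) (V : lmodType A)
  (B W : set V) : {subset K' <= K} -> finlen K' B W -> finlen K B W.
Proof.
move=> KK' [r [n rP]]; exists r, n => U U' kU kU'; apply: rP;
  exact: ksub_weak KK' _.
Qed.

Lemma lin_klin (A : pzRingType) (K : {pred A}) (V W : lmodType A)
  (f : V -> W) : lin f -> klin K f.
Proof. by move=> [fD fZ]; split=> // a x _; exact: fZ. Qed.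

Lemma submod_ksub (A : pzRingType) (V : lmodType A) (U : {pred V}) :
  submod_closed U <-> ksub predT [set x | x \in U].
Proof.
split=> [cU|[U0 UB UZ]].
  have [U0 UB] := GRing.submod_closedB cU.
  split=> [//|x y|a x _ Ux]; first exact: UB.
  by case: cU => _ UL; rewrite /= -[_ *: _]addr0; exact: UL.
split=> [//|a x y Ux Uy]; rewrite -[y]opprK; apply: (UB); first exact: UZ.
by rewrite -sub0r; exact: UB.
Qed.

(** * Semigroups of nilpotent endomorphisms *)

Section Levitzki.
Variables (A : pzRingType) (K : {pred A}) (V : lmodType A).
Implicit Types (S : set (V -> V)) (B W : set V).

(** Engel's argument, by induction on the rank of [W], everything being taken
    modulo [B].  If some [s] does not kill [W], the semigroup [s S] acts on the
    image of [s], which is smaller because [s] is nilpotent.  So [s S] kills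
    some nonzero [w] there; then either [S] kills [w], or the [S]-stable common
    kernel of [s] and [s S] is nonzero, and it is smaller than [W]. *)
Lemma engel S B W : ksub K B -> ksub K W -> B `<=` W ->
  finlen K B W -> (forall s, S s -> lin s) ->
  (forall s t, S s -> S t -> S (s \o t)) ->
  (forall s x, S s -> B x -> B (s x)) -> (forall s x, S s -> W x -> W (s x)) ->
  (forall s, S s -> exists k, forall x, W x -> B (iter k s x)) ->
  ~ W `<=` B -> exists w, [/\ W w, ~ B w & forall s, S s -> B (s w)].
Proof.
move=> kB kW0 BW0 flW.
have [Wt [W1W [rho [n rhoP]]]] : exists Wt, W `<=` Wt /\ finlen K B Wt.
  by exists W; split=> // x.
have [m rhom] := ubnP (rho W).
elim: m S W kW0 BW0 {flW} W1W rhom => // m IH S W1 kW BW W1W rhom.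
move=> linS SS SB SW nilS WB.
have smaller X : ksub K X -> B `<=` X -> X `<=` W1 -> ~ W1 `<=` X ->
    (rho X < m)%N.
  move=> kX BX XW1 W1X; have [//|//|//|//|//|_ _ eqr] := rhoP X W1.
  by rewrite ltnS in rhom; apply: leq_trans rhom; rewrite ltnNge; apply/negP =>
    /eqr.
have [SWB|] := pselect (forall s x, S s -> W1 x -> B (s x)).
  have [w [Ww Bw]] : exists w, W1 w /\ ~ B w.
    apply: contrapT => h; apply: (WB) => w Ww.
    by apply: contrapT => Bw; apply: (h); exists w.
  by exists w; split=> // s Ss; exact: SWB.
move=> /existsNP[s /existsNP[x0 /not_implyP[Ss /not_implyP[Wx0 Bx0]]]].
have [sD sZ] := linS _ Ss.
pose sW := sumset B [set y | exists2 x, W1 x & y = s x].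
have kim : ksub K [set y | exists2 x, W1 x & y = s x].
  by have := ksub_image (lin_klin K (linS _ Ss)) kW.
have ksW : ksub K sW by exact: ksub_sumset.
have sWW1 : sW `<=` W1.
  by apply: (sumset_sub kW) => // _ [x Wx ->]; exact: SW.
have sWpr : ~ W1 `<=` sW.
  move=> W1sW; have [k sk] := nilS _ Ss; apply: (WB) => y Wy.
  suff: forall i x, W1 x -> exists2 u, W1 u & B (x - iter i s u).
    move=> /(_ k _ Wy)[u /sk Bu Byu].
    by rewrite -[y](subrK (iter k s u)); exact: (ksubD kB).
  elim=> [|i IHi] x Wx; first by exists x; rewrite //= subrr; case: kB.
  have [u Wu Bxu] := IHi _ Wx; have [b Bb [v Wv bv]] := W1sW _ Wu.
  exists v => //; rewrite iterSr -bv.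
  rewrite (addBf _ _ (proj1 (lin_iter i (linS _ Ss)))) opprB addrC addrAC
    -addrA.
  apply: (ksubD kB) => //.
  by elim: i {IHi Bxu} => [|i IHi] //=; exact: SB.
have [|||||||||w [sWw Bw stw]] :=
    IH [set f | exists2 t, S t & f = s \o t] sW ksW.
- exact: (sumsetl kim).
- exact: subset_trans W1W.
- apply: smaller => //; exact: (sumsetl kim).
- by move=> _ [t St ->]; apply: lin_comp; exact: linS.
- move=> _ _ [t St ->] [u Su ->]; exists (t \o (s \o u)) => //.
  by apply: (SS) => //; exact: SS.
- by move=> _ x [t St ->] Bx /=; apply: (SB) => //; exact: SB.
- move=> _ x [t St ->] /sWW1 Wx; apply: (sumsetr kB).
  by exists (t x) => //; exact: SW.
- move=> _ [t St ->]; have [k sk] := nilS _ (SS _ _ Ss St).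
  by exists k => x /sWW1; exact: sk.
- by move=> /(_ (s x0)) h; apply: Bx0; apply: (h); apply: (sumsetr kB);
    exists x0.
have Ww := sWW1 _ sWw.
have [kill|/existsNP[t /not_implyP[St Btw]]] :=
    pselect (forall t, S t -> B (t w)); first by exists w.
pose X := [set x | [/\ W1 x, B (s x) & forall t, S t -> B (s (t x))]].
have kX : ksub K X.
  case: (kW) (kB) => [W0 WB' WZ] [B0 BB BZ]; split.
  - split=> //; first by rewrite (add0f sD).
    by move=> u Su; rewrite (add0f (proj1 (linS _ Su))) (add0f sD).
  - move=> x y [Wx Bx Sx] [Wy By Sy]; split.
    + exact: WB'.
    + by rewrite (addBf _ _ sD); exact: BB.
    + move=> u Su; rewrite (addBf _ _ (proj1 (linS _ Su))) (addBf _ _ sD).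
      by apply: (BB); [exact: Sx|exact: Sy].
  - move=> a x aK [Wx Bx Sx]; split.
    + exact: WZ.
    + by rewrite sZ; exact: BZ.
    + by move=> u Su; rewrite (proj2 (linS _ Su)) sZ; apply: (BZ) => //;
        exact: Sx.
have BX : B `<=` X.
  move=> x Bx; split; [exact: BW|exact: SB|].
  by move=> u Su; do 2!apply: (SB) => //.
have XW1 : X `<=` W1 by move=> x [].
have Xpr : ~ W1 `<=` X by move=> /(_ _ Wx0)[].
have [//|||//|//|//||||v [Xv Bv Sv]] := IH S X kX.
- exact: subset_trans W1W.
- exact: smaller.
- move=> u x Su [Wx Bx Sx]; split; [exact: SW|exact: Sx|].
  by move=> u' Su'; apply: (Sx (u' \o u)); exact: SS.
- by move=> u /nilS[k uk]; exists k => x /XW1; exact: uk.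
- move=> /(_ (t w)) h; apply: Btw; apply: (h); split; first exact: SW.
    by apply: (stw (s \o t)); exists t.
  by move=> u Su; apply: (stw (s \o (u \o t))); exists (u \o t) => //;
    exact: SS.
by exists v; split=> //; exact: XW1.
Qed.

Fixpoint killed_by S (k : nat) : set V :=
  if k is k'.+1 then [set x | forall s, S s -> killed_by S k' (s x)]
  else [set 0].

Lemma ksub_killed_by S k : (forall s, S s -> lin s) -> ksub K (killed_by S k).
Proof.
move=> linS; elim: k => [|k [k0 kB kZ]]; first exact: ksub0.
split=> [s Ss|x y hx hy s Ss|a x aK hx s Ss] /=.
- by rewrite (add0f (proj1 (linS _ Ss))).
- by rewrite (addBf _ _ (proj1 (linS _ Ss))); apply: kB; [exact: hx|exact: hy].
- by rewrite (proj2 (linS _ Ss)); apply: kZ => //; exact: hx.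
Qed.

(** Levitzki's theorem.  The spaces killed by the words of length [k]
    grow until Engel's argument finds nothing new. *)
Lemma levitzki S W : ksub K W -> finlen K [set 0] W ->
  (forall s, S s -> lin s) -> (forall s t, S s -> S t -> S (s \o t)) ->
  (forall s x, S s -> W x -> W (s x)) ->
  (forall s, S s -> exists k, forall x, W x -> iter k s x = 0) ->
  exists k, W `<=` killed_by S k.
Proof.
move=> kW flW linS SS SW nilS.
pose U k := killed_by S k `&` W.
have kU k : ksub K (U k) by apply: ksubI => //; exact: ksub_killed_by.
have US s k x : S s -> U k.+1 x -> U k (s x).
  by move=> Ss [Ux Wx]; split; [exact: Ux|exact: SW].
have Umono k : U k `<=` U k.+1.
  elim: k => [|k IH] x [kx Wx]; split=> // s Ss.
    by rewrite kx (add0f (proj1 (linS _ Ss))).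
  by apply: (proj1 (IH _ (US _ _ _ Ss (conj kx Wx)))).
have U0 k : [set 0] `<=` U k by move=> _ ->; case: (kU k).
have [rho [n rhoP]] := flW.
have [||k [_ kmax]] := @nat_max nat (fun=> True) (fun k => rho (U k)) n.
- by exists 0%N.
- by move=> k _; have [] := rhoP (U k) (U k) => // x [].
exists k; apply: contrapT => Wk.
have [//|//|x []//||//|//||//|||w [Ww Uw Sw]] := @engel S (U k) W.
- exact: finlen_sub flW.
- by move=> s x Ss Ux; apply: (US _ _ _ Ss); exact: Umono.
- move=> s /nilS[j sj]; exists j => x Wx; rewrite sj//.
  by case: (kU k).
- by move=> WU; apply: Wk => x /WU[].
apply: Uw; have [//|//|//|//|x []//|_ _] := rhoP (U k) (U k.+1).
move=> /(_ (kmax k.+1 I)) h; apply: (h); split=> // s Ss.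
by case: (Sw _ Ss).
Qed.

(** Fitting's lemma, for a map whose image lies in a piece of finite length.
    The idempotent projects onto the stable image along the stable kernel. *)
Lemma fitting (h : V -> V) W : ksub K W -> finlen K [set 0] W -> lin h ->
  (forall x, W (h x)) ->
  exists e : V -> V, [/\ lin e, forall x, e (e x) = e x,
    forall x, exists y, e x = h y,
    forall t : V -> V, lin t \/ klin K t -> (forall x, t (h x) = h (t x)) ->
      forall x, t (e x) = e (t x) &
    [/\ forall x, h x = x -> e x = x, forall x, h x = 0 -> e x = 0,
        exists k, forall x, e x = 0 -> iter k h x = 0 &
        (forall x, W x -> h x = 0 -> x = 0) -> forall x, W x -> e x = x]].
Proof.
move=> kW flW lh Wh; have [hD hZ] := lh.
have li k := lin_iter k lh.
have [rho [n rhoP]] := flW.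
pose Im k := [set y | exists x, y = iter k.+1 h x].
have kIm k : ksub K (Im k).
  split=> [|_ _ [x ->] [y ->]|a _ aK [x ->]].
  - by exists 0; rewrite (add0f (proj1 (li k.+1))).
  - by exists (x - y); rewrite (addBf _ _ (proj1 (li k.+1))).
  - by exists (a *: x); rewrite (proj2 (li k.+1)).
have ImW k : Im k `<=` W by move=> _ [x ->]; exact: Wh.
have Imdec k j : Im (k + j)%N `<=` Im k.
  by move=> _ [x ->]; exists (iter j h x); rewrite -iterD addSn.
pose Ke k := [set x | iter k h x = 0] `&` W.
have kKe k : ksub K (Ke k).
  apply: ksubI => //; apply: (@ksub_preim _ _ _ _ _ [set 0]) (ksub0 _ _).
  exact: lin_klin.
have Kinc k j : Ke k `<=` Ke (k + j)%N.
  by move=> x [/= kx Wx]; split;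
    rewrite //= addnC iterD kx (add0f (proj1 (li j))).
have z0 U : ksub K U -> [set 0] `<=` U by move=> [? _ _] _ ->.
have [|k1 [_ k1min]] := @nat_min nat (fun=> True) (fun k => rho (Im k)).
  by exists 0%N.
have [||k2 [_ k2max]] := @nat_max nat (fun=> True) (fun k => rho (Ke k)) n.
- by exists 0%N.
- move=> k _; have [//|//||//|x []//|//] := rhoP (Ke k) (Ke k).
  exact: z0.
have Imst j : Im k1 `<=` Im (k1 + j)%N.
  have [//|//||||_ _] := rhoP (Im (k1 + j)%N) (Im k1).
  - exact: z0.
  - exact: Imdec.
  - exact: ImW.
  - by apply; exact: k1min.
have Kest j : Ke (k2 + j)%N `<=` Ke k2.
  have [//|//||||_ _] := rhoP (Ke k2) (Ke (k2 + j)%N).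
  - exact: z0.
  - exact: Kinc.
  - by move=> x [].
  - by apply; exact: k2max.
pose D := Im k1.
pose M := (k1 + k2).+1.
have DM x : D (iter M h x).
  by exists (iter k2 h x); rewrite -iterD /M addSn.
have DinjM d : D d -> iter M h d = 0 -> d = 0.
  move=> /(Imst k2.+1)[x ->] h0.
  have : Ke (k2 + (M + k1).+1)%N (h x).
    split; last exact: Wh.
    rewrite /= -h0 -iterSr -iterD; congr (iter _ h x); rewrite /M; lia.
  move=> /Kest[/= hx _].
  by rewrite -iterS -addSn iterD [iter k2.+1 h x]iterSr hx (add0f (proj1 (li
    k1.+1))).
have DsurM x : exists2 d, D d & iter M h d = iter M h x.
  have /(Imst M)[y yE] : D (iter M h x) by exact: DM.
  exists (iter k1.+1 h y); first by exists y.
  by rewrite yE -iterD; congr (iter _ h y); lia.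
pose e x := sval (cid2 (DsurM x)).
have eD x : D (e x) by rewrite /e; case: cid2.
have eM x : iter M h (e x) = iter M h x by rewrite /e; case: cid2.
have uniq d d' : D d -> D d' -> iter M h d = iter M h d' -> d = d'.
  move=> Dd Dd' dd'; apply/eqP; rewrite -subr_eq0; apply/eqP/DinjM.
    by case: (kIm k1) => _ B _; exact: B.
  by rewrite (addBf _ _ (proj1 (li M))) dd' subrr.
have le : lin e.
  split=> [x y|a x]; apply: (uniq) => //.
  - by apply: (ksubD (kIm k1)); exact: eD.
  - by rewrite eM !(proj1 (li M)) !eM.
  - have [y ->] := eD x; exists (a *: y); exact/esym/(proj2 (li k1.+1)).
  - by rewrite eM !(proj2 (li M)) !eM.
have eid d : D d -> e d = d by move=> Dd; apply: (uniq).
exists e; split=> //.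
- by move=> x; exact: eid.
- by move=> x; have [y ->] := eD x; exists (iter k1 h y).
- move=> t _ th x.
  have tM k y : t (iter k h y) = iter k h (t y).
    by elim: k => //= k <-; rewrite th.
  apply: (uniq) => //; last by rewrite -tM !eM tM.
  by have [y ->] := eD x; exists (t y); exact: tM.
split.
- move=> x hx; apply: eid; exists x; elim: k1.+1 => //= k <-; exact/esym.
- move=> x hx; apply: (uniq) => //; first by case: (kIm k1).
  by rewrite eM (add0f (proj1 (li M))) iterSr hx (add0f (proj1 (li _))).
- by exists M => x ex; rewrite -eM ex (add0f (proj1 (li M))).
- move=> inj x Wx; apply/esym/eqP; rewrite -subr_eq0; apply/eqP.
  have : iter M h (x - e x) = 0 by rewrite (addBf _ _ (proj1 (li M))) eM subrr.
  have : W (x - e x) by case: (kW) => _ B _; apply: B => //; exact: ImW (eD x).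
  by elim: (M) (x - e x) => [//|k IH] y Wy; 
  by rewrite iterSr => /(IH _ (Wh y)); exact: inj.
Qed.

End Levitzki.

(** * Right artinian basic rings have finite length *)

Section Submodules.
Variables (A : pzRingType) (V : lmodType A).
Implicit Types (U B W : set V).

Definition span (S : set V) : set V :=
  [set x | forall U, ksub predT U -> S `<=` U -> U x].

Lemma sub_span S : S `<=` span S.
Proof. by move=> x Sx U _; exact. Qed.

Lemma ksub_span S : ksub predT (span S).
Proof.
split=> [U [U0 _ _] _ //|x y Sx Sy U kU SU|a x _ Sx U kU SU].
  by case: (kU) => _ UB _; apply: (UB); [exact: Sx|exact: Sy].
by case: (kU) => _ _ UZ; apply: (UZ) => //; exact: Sx.
Qed.

Lemma span_min S U : ksub predT U -> S `<=` U -> span S `<=` U.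
Proof. by move=> kU SU x; exact. Qed.

Lemma max_avoiding (K : {pred A}) B W (y : V) :
  ksub K B -> ksub K W -> B `<=` W -> ~ B y ->
  exists C, [/\ ksub K C, B `<=` C, C `<=` W, ~ C y &
    forall U, ksub K U -> C `<=` U -> U `<=` W -> ~ U y -> U `<=` C].
Proof.
move=> kB kW BW By.
pose good X := [/\ ksub K X, B `<=` X, X `<=` W & ~ X y].
have goodB : good B by split.
have [|C [PC Cmax]] := @Zorn_bigcup V [set X | X = set0 \/ good X].
  move=> F FP Ftot.
  have [[X0 FX0 gX0]|nog] := pselect (exists2 X, F X & good X); last first.
    left; apply/seteqP; split=> // x [X FX Xx].
    by have [X0|gX] := FP _ FX; [rewrite X0 in Xx|apply: nog; exists X].
  have gF X x : F X -> X x -> good X by move=> /FP[-> //|].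
  right; split.
  - split.
    + by exists X0 => //; case: gX0 => -[].
    + move=> u v [X FX Xu] [X' FX' X'v].
      have [[_ XB _] _ _ _] := gF _ _ FX Xu.
      have [[_ X'B _] _ _ _] := gF _ _ FX' X'v.
      have [XX'|X'X] := Ftot _ _ FX FX'; [exists X' => //|exists X => //].
        by apply: (X'B) => //; exact: XX'.
      by apply: (XB) => //; exact: X'X.
    + move=> a u aK [X FX Xu]; exists X => //.
      by have [[_ _ XZ] _ _ _] := gF _ _ FX Xu; exact: XZ.
  - by move=> x Bx; exists X0 => //; case: gX0 => _ BX0 _ _; exact: BX0.
  - by move=> x [X FX Xx]; have [_ _ XW _] := gF _ _ FX Xx; exact: XW.
  - by move=> [X FX Xy]; have [_ _ _] := gF _ _ FX Xy.
have {PC}gC : good C.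
  case: PC => // C0; exfalso; apply: (Cmax B); last by right.
  rewrite C0; split=> // h.
  by have [/(h _)] := kB.
case: (gC) => kC BC CW Cy; exists C; split=> // U kU CU UW Uy.
apply: contrapT => UC; apply: (Cmax U); first by split.
by right; split=> //; exact: subset_trans CU.
Qed.

Lemma artinian_min (F : set V -> Prop) : artinian V ->
  (forall U, F U -> ksub predT U) -> (exists U, F U) ->
  exists U, F U /\ forall U', F U' -> U' `<=` U -> U `<=` U'.
Proof.
move=> artV Fk [U0 FU0]; apply: contrapT => nomin.
have next (u : {U | F U}) : exists u' : {U | F U},
    sval u' `<=` sval u /\ ~ sval u `<=` sval u'.
  apply: contrapT => h; apply: nomin; exists (sval u); split;
    first exact: svalP.
  move=> U' FU' U'U; apply: contrapT => UU'; apply: h.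
  by exists (exist _ U' FU').
pose nx u := sval (cid (next u)).
have nxP u : sval (nx u) `<=` sval u /\ ~ sval u `<=` sval (nx u).
  exact: svalP (cid (next u)).
pose u n := iter n nx (exist _ U0 FU0).
have [||n nst] := artV (fun n => [pred x | `[< sval (u n) x >]]).
- move=> n; apply/submod_ksub.
  have [U0' UB UZ] := Fk _ (svalP (u n)).
  split=> [|x y /asboolP Ux /asboolP Uy|a x aK /asboolP Ux]; apply/asboolP=> //.
    exact: UB.
  exact: UZ.
- by move=> n x /asboolP ux; apply/asboolP; exact: (proj1 (nxP (u n))).
have [_ ] := nxP (u n); apply=> x ux.
have := nst n.+1 (leqnSn n) x.
by rewrite !inE (asboolT ux) => /asboolP.
Qed.

End Submodules.

Section Artinian.
Variables (R : pzRingType).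
Implicit Types (U : set R) (x r : R).

Definition rideal U := ksub (V := (R^c)^o) predT U.

Lemma ridealP U : rideal U <-> [/\ U 0, forall x y, U x -> U y -> U (x - y) &
  forall x r, U x -> U (x * r)].
Proof.
split=> [[U0 UB UZ]|[U0 UB UM]].
  by split=> // x r; exact: (UZ r x isT).
by split=> // a x _; exact: UM.
Qed.

Lemma rideal_setT : rideal setT.
Proof. by []. Qed.

Lemma rideal_min (F : set R -> Prop) : right_artinian R ->
  (forall U, F U -> rideal U) -> (exists U, F U) ->
  exists U, F U /\ forall U', F U' -> U' `<=` U -> U `<=` U'.
Proof. exact: (@artinian_min _ (R^c)^o). Qed.

Lemma rideal_max U W x : rideal U -> rideal W -> U `<=` W -> ~ U x ->
  exists C, [/\ rideal C, U `<=` C, C `<=` W, ~ C x &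
    forall X, rideal X -> C `<=` X -> X `<=` W -> ~ X x -> X `<=` C].
Proof. exact: (@max_avoiding _ (R^c)^o). Qed.

Lemma rideal_mul U (u : R) : rideal U ->
  rideal [set z | exists2 j, U j & z = u * j].
Proof.
move=> /ridealP[U0 UB UM]; apply/ridealP; split.
- by exists 0; rewrite ?mulr0.
- by move=> _ _ [x Ux ->] [y Uy ->]; exists (x - y); [exact: UB|rewrite mulrBr].
- by move=> _ r [x Ux ->]; exists (x * r); [exact: UM|rewrite mulrA].
Qed.

Lemma rideal_ann (u : R) : rideal [set z | u * z = 0].
Proof.
apply/ridealP; split=> [|x y /= ux uy|x r /= ux]; first exact: mulr0.
  by rewrite mulrBr ux uy subrr.
by rewrite mulrA ux mul0r.
Qed.

Lemma rideal_jacobson : rideal [set x | x \in @jacobson R].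
Proof.
apply/ridealP; have [J0 JB] := jacobson_zmod_closed R.
split=> [//|x y|x r]; [exact: JB|exact: jacobsonMr].
Qed.

Lemma jacobson_quasireg x : x \in @jacobson R -> exists z, (1 - x) * z = 1.
Proof.
move=> Jx; pose B := [set z : R | exists2 j, [set: R] j & z = (1 - x) * j].
have kB : rideal B by apply: rideal_mul; exact: rideal_setT.
have [[z _ zE]|B1] := pselect (B 1); first by exists z.
have [//|//|//|C [kC BC _ C1 Cmax]] :=
  @rideal_max B setT 1 kB.
have [C0 CB CM] := (ridealP C).1 kC.
pose p : {pred (R^c)^o} := fun z => `[< C z >].
suff /(jacobsonP _ Jx)/asboolP Cx : maximal_right_ideal p.
  exfalso; apply: C1; rewrite -[1](subrK x).
  apply: (ksubD kC) => //; apply: BC; exists 1 => //; rewrite mulr1//.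
split.
  apply/submod_ksub; split=> [|u v /asboolP Cu /asboolP Cv|a u _ /asboolP Cu];
    apply/asboolP; [exact: C0|exact: CB|exact: CM].
split=> [//|/(_ 1 isT)/asboolP //|W /submod_ksub kW pW _].
have [W1|W1] := pselect ((1 : R) \in W).
  right=> u; rewrite [RHS]inE -[u](mul1r (u : R)).
  by have [_ _ WZ] := kW; exact: (WZ u 1 isT W1).
left=> u; apply/idP/idP => [Wu|]; last exact: pW.
apply/asboolP; apply: (Cmax _ kW) => // v Cv.
by apply: pW; apply/asboolP.
Qed.

Fixpoint jpow (k : nat) : set R :=
  if k is k'.+1 then
    span (V := (R^c)^o) [set z | exists x p, [/\ x \in @jacobson R, jpow k' p &
      z = x * p :> R]]
  else setT.

Lemma rideal_jpow k : rideal (jpow k).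
Proof. by case: k => [|k]; [exact: ksubT|exact: ksub_span]. Qed.

Lemma jpowS k : jpow k.+1 `<=` jpow k.
Proof.
elim: k => [//|k IH].
apply: (@span_min _ (R^c)^o); first exact: (rideal_jpow k.+1).
by move=> _ [x [p [Jx /IH pk ->]]]; apply: sub_span; exists x, p.
Qed.

Hypothesis artR : right_artinian R.

(** Let [K] be the stable power of the radical and [U] a minimal right ideal
    with [U K <> 0].  As [K = J K], some [u J] with [u] in [U] has the same
    property, so [u] lies in [u J]; but elements of the radical are
    quasiregular, whence [u = 0]. *)
Lemma jacobson_nilpotent : exists k, jpow k `<=` [set 0].
Proof.
have [||_ [[k ->] kmin]] :=
  rideal_min (F := fun U => exists k, U = jpow k) artR.
- by move=> _ [k ->]; exact: rideal_jpow.
- by exists (jpow 0), 0%N.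
exists k; apply: contrapT => k0.
have Kst : jpow k `<=` jpow k.+1 by apply: kmin; [exists k.+1|exact: jpowS].
have [||U [[kU [u [p [Uu Kp up]]]] Umin]] := rideal_min (F := fun U =>
  rideal U /\ exists u p : R, [/\ U u, jpow k p & u * p <> 0]) artR.
- by move=> U [].
- exists setT; split; first exact: ksubT.
  have [p [Kp p0]] : exists p, jpow k p /\ p <> 0.
    apply: contrapT => h; apply: k0 => p Kp; apply: contrapT => p0.
    by apply: h; exists p.
  by exists 1, p; rewrite mul1r.
have [x [q [Jx Kq xq]]] : exists x q,
    [/\ x \in @jacobson R, jpow k q & u * (x * q) <> 0].
  apply: contrapT => h; apply: up.
  apply: (Kst p Kp [set z | u * z = 0]); first exact: rideal_ann.
  move=> _ [x [q [Jx Kq ->]]]; apply: contrapT => uxq; apply: h.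
  by exists x, q.
have [||j Jj uj] := Umin [set z | exists2 j,
  j \in @jacobson R & z = u * j] _ _ u Uu.
- split; first exact: rideal_mul rideal_jacobson.
  by exists (u * x), q; split=> //; [exists x|rewrite -mulrA].
- by move=> _ [j _ ->]; have [_ _] := (ridealP U).1 kU; exact.
have [z jz] := jacobson_quasireg Jj.
apply: up; suff -> : u = 0 by rewrite mul0r.
by rewrite -[u]mulr1 -jz mulrA mulrBr mulr1 -uj subrr mul0r.
Qed.

Hypothesis basicR : basic R.

Lemma basic_components : exists (I : Type) (D : I -> pzRingType)
    (f : forall i, R -> D i), [/\ forall i, division_ring (D i),
  forall i, f i 1 = 1 /\ forall x y, f i (x - y) = f i x - f i y,
  forall i x y, f i (x * y) = f i x * f i y,
  forall x, (forall i, f i x = 0) -> x \in @jacobson R &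
  forall d : forall i, D i, exists x, forall i, f i x = d i].
Proof.
have [I [D [divD [f fbij]]]] := basicR; have [h fK hK] := fbij.
pose p (x : R) : radical_quotient R := \pi_(radical_quotient R) x.
have pB x y : p (x - y) = p x - p y by exact: raddfB.
have pM x y : p (x * y) = p x * p y by exact/esym/radical_quotient_mulE.
exists I, D, (fun i x => f i (p x)); split=> // [i|i x y|x fx|d].
- by split=> [|x y]; [exact: (rmorph1 (f i))|rewrite pB raddfB].
- by rewrite pM rmorphM.
- rewrite -[x]subr0; apply/radical_quotient_piP; apply: (bij_inj fbij).
  apply: functional_extensionality_dep => i.
  have p0 : p 0 = 0 by rewrite -(subrr (0 : R)) pB subrr.
  by rewrite -/(p x) -/(p 0) fx p0 raddf0.
- by exists (repr (h d)) => i; rewrite /p reprK -[in RHS](hK d).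
Qed.

Lemma nilpotent_in_jacobson x k : x ^+ k = 0 -> x \in @jacobson R.
Proof.
have [I [D [f [divD f1 fM fJ _]]]] := basic_components.
move=> xk; apply: fJ => i; have [D1 Dinv] := divD i; have [fi1 fiB] := f1 i.
apply: contrapT => /Dinv[y [xy _]].
suff h n : f i (x ^+ n) <> 0 by apply: (h k); rewrite xk -(subrr 0) fiB subrr.
elim: n => [|n IH] xn; first by rewrite expr0 fi1 in xn.
apply: IH; rewrite -[LHS]mulr1 -xy mulrA -fM -exprSr xn mul0r//.
Qed.

(** Modulo the radical the ring is strongly regular: [r r'] is the central
    idempotent supporting [r]. *)
Lemma basic_regular r : exists r', r * (r * r') - r \in @jacobson R /\
  forall t, (1 - r * r') * t * (r * r') \in @jacobson R.
Proof.
have [I [D [f [divD f1 fM fJ fsurj]]]] := basic_components.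
have inv i : exists d : D i,
  (f i r <> 0 -> f i r * d = 1) /\ (f i r = 0 -> d = 0).
  have [r0|/(proj2 (divD i))[y [ry _]]] := pselect (f i r = 0).
    by exists 0; split.
  by exists y; split=> // r0; have [] := divD i; rewrite -ry r0 mul0r.
have [r' r'E] := fsurj (fun i => sval (cid (inv i))).
exists r'; split=> [|t]; apply: fJ => i; have [fi1 fiB] := f1 i;
  have [d1 d0] := svalP (cid (inv i)); rewrite -r'E in d1 d0.
  rewrite fiB !fM; have [r0|/d1 ->] := pselect (f i r = 0).
    by rewrite r0 !mul0r subrr.
  by rewrite mulr1 subrr.
rewrite !fM fiB fM fi1; have [r0|/d1 ->] := pselect (f i r = 0).
  by rewrite r0 mul0r mulr0.
by rewrite subrr !mul0r.
Qed.

(** Hopkins' theorem.  Let [Y] be minimal among the right ideals that are not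
    of finite length.  As the radical [J] is nilpotent there is a submodule of
    [Y] containing [Y J] but not all of [Y], hence a submodule [C] that is
    maximal among those containing [Y J] and avoiding some [y] in [Y].  As
    [Y / Y J] is semisimple, [Y = C + y R], so that [C] has colength one in [Y];
    but [C] has finite length by minimality. *)
Lemma basic_artinian_finlen : finlen (V := (R^c)^o) predT [set 0] setT.
Proof.
apply: contrapT => Rinf.
have [||Y [[kY Yinf] Ymin]] := rideal_min (F := fun U =>
  rideal U /\ ~ finlen (V := (R^c)^o) predT [set 0] U) artR.
- by move=> U [].
- by exists setT; split=> //; exact: ksubT.
pose kills k := forall y p, Y y -> jpow k p -> y * p = 0.
have [k kk kmin] : exists2 k, kills k & forall j, kills j -> (k <= j)%N.
  have [k Jk] := jacobson_nilpotent.
  have [|j [kj jmin]] := @nat_min nat kills id; last by exists j.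
  by exists k => y p _ /Jk ->; rewrite mulr0.
case: k kk kmin => [|k] kk kmin.
  apply: Yinf; exists (fun=> 0%N), 0%N => U U' kU _ _ _ U'Y; split=> // _ x Ux.
  rewrite -[x](mulr1 (x : R)) kk//; first by case: kU.
  exact: U'Y.
have [y [p [Yy Jp yp]]] : exists y p, [/\ Y y, jpow k p & y * p <> 0].
  apply: contrapT => h; suff /kmin : kills k by rewrite ltnn.
  move=> y p Yy Jp; apply: contrapT => yp; apply: h; by exists y, p.
have [Y0 YB YM] := (ridealP Y).1 kY.
pose W := [set z | Y z /\ forall r p, jpow k p -> z * r * p = 0].
have kW : rideal W.
  apply/ridealP; split.
  - by split=> // r q _; rewrite !mul0r.
  - move=> z z' [Yz Wz] [Yz' Wz']; split=> [|r q Jq]; first exact: YB.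
    by rewrite !mulrBl Wz// Wz'// subrr.
  - move=> z t [Yz Wz]; split=> [|r q Jq]; first exact: YM.
    by rewrite -[z * t * r]mulrA Wz.
have WJ z j : Y z -> j \in @jacobson R -> W (z * j).
  move=> Yz Jj; split=> [|r q Jq]; first exact: YM.
  rewrite -!mulrA kk//; apply: sub_span; exists (j * r), q; split=> //.
    exact: jacobsonMr.
  by rewrite mulrA.
have [||C [kC WC CY Cy Cmax]] := @rideal_max W Y y kW kY.
- by move=> z [].
- by move=> [_ /(_ 1 p Jp)]; rewrite mulr1.
have [C0 CB CM] := (ridealP C).1 kC.
have CD u v : C u -> C v -> C (u + v) by exact: (ksubD kC).
have Cgen z : Y z -> ~ C z -> exists c r, C c /\ y = c + z * r.
  move=> Yz Cz.
  pose X := sumset (V := (R^c)^o) C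
    [set v | exists2 j : R, [set: R] j & v = z * j].
  have kzR : rideal [set v | exists2 j : R, [set: R] j & v = z * j].
    apply: rideal_mul; exact: rideal_setT.
  apply: contrapT => h; apply: Cz; apply: (Cmax X).
  - exact: ksub_sumset.
  - exact: sumsetl kzR.
  - by apply: (sumset_sub kY) => // _ [j _ ->]; exact: YM.
  - move=> [c Cc [j _ yc]]; apply: h; exists c, j; split=> //.
    by rewrite -yc addrC subrK.
  - by apply: (sumsetr kC); exists 1; rewrite ?mulr1.
have big U : rideal U -> C `<=` U -> U y -> Y `<=` U.
  move=> kU CU Uy z Yz; have [/CU //|Cz] := pselect (C z).
  have [U0 UB UM] := (ridealP U).1 kU.
  have [c [r [Cc yE]]] := Cgen _ Yz Cz.
  have [r' [reJ eJ]] := basic_regular r.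
  set e := r * r' in reJ eJ.
  have ze : U (z * e).
    have -> : z * e = y * r' - c * r' by rewrite -mulrBl yE addrAC subrr add0r
      mulrA.
    by apply: (UB); apply: (UM) => //; exact: CU.
  clearbody e.
  rewrite -[z](subrK (z * e)); apply: (ksubD kU) => //; apply: CU.
  apply: contrapT => /Cgen[|c2 [r2 [Cc2 yE2]]]; first by apply: (YB) => //;
    exact: YM.
  have Cye : C (y * e).
    have -> : y * e = c2 * e + z * ((1 - e) * r2 * e).
      have -> : z * ((1 - e) * r2 * e) = (z - z * e) * r2 * e.
        by rewrite !mulrA mulrBr mulr1.
      by rewrite yE2 mulrDl.
    by apply: (CD); [exact: CM|apply: WC; exact: WJ].
  apply: Cy; rewrite -[y](subKr (y * e)); apply: (CB) => //.
  have -> : y * e - y = (c * e - c) + z * (r * e - r).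
    by rewrite {1 2}yE mulrDl mulrBr opprD addrACA mulrA.
  by apply: (CD); [apply: (CB) => //; exact: CM|apply: WC; exact: WJ].
apply: Yinf; apply: (finlen_trans (V := (R^c)^o) kC) => //.
- by move=> _ ->.
- apply: contrapT => Cinf.
  by apply: Cy; apply: (Ymin C).
exists (fun U => nat_of_bool `[< U y >]), 1%N => U U' kU kU' CU UU' U'Y.
split; last 1 first.
- have [Uy|Uy] := pselect (U y).
    by move=> _; apply: subset_trans U'Y _; exact: big.
  rewrite (asboolF Uy); case: asboolP => // U'y _ x U'x.
  by apply: (CU); apply: (Cmax _ kU') => //; apply: subset_trans UU'.
- by case: asboolP => // Uy; rewrite asboolT//; exact: UU'.
- by case: asboolP.
Qed.

End Artinian.

(** * Gradings of right artinian basic rings *)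

Lemma dsum_bounded (V : zmodType) (c : dsum int V) :
  exists q : nat, forall n, (q < `|n|)%N -> c n = 0.
Proof.
have [B Bc] := fset_supp (dsum_finite c).
exists (\max_(i <- B) `|i|%N) => n qn; apply: Bc; apply/negP => nB.
by have := @leq_bigmax_seq _ _ xpredT absz n nB isT; rewrite leqNgt qn.
Qed.

Section GradedRing.
Variables (R : pzRingType) (g : grading R).
Implicit Types (x y r : R).
Local Notation comp := (component g).

Lemma component_ext x y : (forall n, comp x n = comp y n) -> x = y.
Proof.
move=> xy; rewrite (component_sum g x) (component_sum g y).
by apply: eq_fsbigr => n _; exact: xy.
Qed.

Lemma componentN x n : comp (- x) n = - comp x n.
Proof. by apply: (@addNf _ _ (comp^~ n)) => u v; exact: componentD. Qed.

Lemma componentB x y n : comp (x - y) n = comp x n - comp y n.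
Proof. by rewrite componentD componentN. Qed.

Lemma componentMl x y i n : x \in g i -> comp (x * y) n = x * comp y (n - i).
Proof.
move=> xi; elim/(homog_ind (g := g)): y => [|y z IHy IHz|k y yk].
- by rewrite mulr0 !component0 mulr0.
- by rewrite mulrDr !componentD IHy IHz mulrDr.
rewrite (component_id _ (homogM xi yk)) (component_id _ yk) subr_eq addrC.
by case: eqP; rewrite ?mulr0.
Qed.

Lemma componentMr x y j n : y \in g j -> comp (x * y) n = comp x (n - j) * y.
Proof.
move=> yj; elim/(homog_ind (g := g)): x => [|x z IHx IHz|k x xk].
- by rewrite mul0r !component0 mul0r.
- by rewrite mulrDl !componentD IHx IHz mulrDl.
rewrite (component_id _ (homogM xk yj)) (component_id _ xk) subr_eq.
by case: eqP; rewrite ?mul0r.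
Qed.

Hypothesis artR : right_artinian R.

(** The chain of right ideals [(1 - r)^n R] becomes stationary and [1 - r] is
    left regular, because [r] shifts degrees; so [1 - r] has a right inverse
    [z].  Its component of degree [k i] can only be [r ^+ k], and almost all
    components of [z] vanish. *)
Lemma homog_nilpotent r i : r \in g i -> i <> 0 -> exists k, r ^+ k = 0.
Proof.
move=> ri i0.
have shift w : (forall n, comp w n = r * comp w (n - i)) -> w = 0.
  move=> wE; apply: component_ext => n; rewrite component0.
  have iterE k : comp w n = r ^+ k * comp w (n - i *+ k).
    elim: k => [|k ->]; first by rewrite expr0 mul1r subr0.
    by rewrite wE mulrA -exprSr mulrSr opprD addrA.
  have [q wq] := dsum_bounded (comp w).
  rewrite (iterE (q + `|n|).+1) wq ?mulr0//.
  rewrite -mulr_natr; nia.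
have reg w : (1 - r) * w = 0 -> w = 0.
  rewrite mulrBl mul1r => /eqP; rewrite subr_eq0 => /eqP wE.
  by apply: shift => n; rewrite {1}wE (componentMl _ _ ri).
have [||_ [[k ->] kmin]] := rideal_min (F := fun U => exists k,
  U = [set x | exists2 z, [set: R] z & x = (1 - r) ^+ k * z]) artR.
- by move=> _ [k ->]; apply: rideal_mul; exact: rideal_setT.
- by eexists; exists 0%N.
have [|||z _ zE] := kmin [set x | exists2 z,
  [set: R] z & x = (1 - r) ^+ k.+1 * z]
    _ _ ((1 - r) ^+ k).
- by exists k.+1.
- by move=> _ [z _ ->]; exists ((1 - r) * z) => //; rewrite mulrA -exprSr.
- by exists 1; rewrite ?mulr1.
have {zE}zE : z = 1 + r * z.
  apply/eqP; rewrite -subr_eq0 opprD addrA; apply/eqP.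
  have -> : z - 1 - r * z = (1 - r) * z - 1 by rewrite mulrBl mul1r addrAC.
  elim: k {kmin} zE => [|k IH]; first by rewrite expr0 expr1 => <-;
    rewrite subrr.
  rewrite !exprS -!mulrA => /eqP; rewrite -subr_eq0 -mulrBr => /eqP/reg/eqP.
  by rewrite subr_eq0 mulrA -exprS => /eqP; exact: IH.
have zn n : comp z n = (if n == 0 then 1 else 0) + r * comp z (n - i).
  by rewrite {1}zE componentD (componentMl _ _ ri) (component_id _ (homog1 g)).
have [q zq] := dsum_bounded (comp z).
have neg m l : comp z (- (i *+ m.+1)) = r ^+ l * comp z (- (i *+ (m.+1 + l))).
  elim: l => [|l ->]; first by rewrite addn0 expr0 mul1r.
  rewrite zn ifF ?add0r; last by apply/negbTE; rewrite -mulr_natr; nia.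
  by rewrite mulrA -exprSr addnS [in RHS]mulrSr opprD.
have z1 : comp z (- i) = 0.
  have := neg 0%N q; rewrite mulr1n => ->; rewrite zq ?mulr0//.
  rewrite -mulr_natr; nia.
have pos m : comp z (i *+ m) = r ^+ m.
  elim: m => [|m IH]; first by rewrite zn eqxx sub0r z1 mulr0 addr0.
  rewrite zn ifF ?add0r; last by apply/negbTE; rewrite -mulr_natr; nia.
  by rewrite mulrSr addrK IH exprS.
exists q.+1; rewrite -pos zq//; rewrite -mulr_natr; nia.
Qed.

Hypothesis basicR : basic R.

(** By the preceding lemmas the components of nonzero degree lie in the radical
    [J], and they generate the same right ideal as those of degree at most [d],
    for some [d].  So an element of degree above [k d] is a sum of products with
    more than [k] factors of nonzero degree, hence lies in a high power of
    [J]. *)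
Lemma grading_finite_support :
  exists s : nat, forall j r, r \in g j -> (s < `|j|)%N -> r = 0.
Proof.
have gJ j r : r \in g j -> j <> 0 -> r \in @jacobson R.
  by move=> rj j0; have [k] := homog_nilpotent rj j0;
    exact: nilpotent_in_jacobson.
pose I d : set R := span (V := (R^c)^o)
  [set r | exists j, [/\ r \in g j, (0 < `|j|)%N & (`|j| <= d)%N]].
have Imono d d' : (d <= d')%N -> I d `<=` I d'.
  move=> dd'; apply: (@span_min _ (R^c)^o); first exact: ksub_span.
  by move=> r [j [rj j0 jd]]; apply: sub_span; exists j; split=> //; lia.
have [rho [n rhoP]] := basic_artinian_finlen artR basicR.
have kI d : rideal (I d) by exact: (@ksub_span _ (R^c)^o).
have I0 d : [set 0] `<=` I d by move=> _ ->; case: (kI d).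
have [||d [_ dmax]] := @nat_max nat (fun=> True) (fun d => rho (I d)) n.
- by exists 0%N.
- by move=> d _; have [//|//|//|//] := rhoP _ _ (kI d) (kI d).
have Id d' : I d' `<=` I d.
  have [/Imono //|/ltnW dd'] := leqP d' d.
  have [//||//|_ _] := rhoP _ _ (kI d) (kI d'); first exact: Imono.
  by apply; exact: dmax.
have deep k j r : r \in g j -> (k * d < `|j|)%N -> jpow k.+1 r.
  elim: k j r => [|k IH] j r rj kj.
    apply: sub_span; exists r, 1; rewrite mulr1; split=> //.
    by apply: gJ rj _ => j0; rewrite j0 in kj.
  pose T := [set x : R | forall t m, (k.+1 * d < `|m|)%N ->
    jpow k.+2 (comp (x * t) m)].
  suff : T r by move=> /(_ 1 j kj); rewrite mulr1 (component_id _ rj) eqxx.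
  have : I d r.
    by apply: (Id `|j|%N); apply: sub_span; exists j; split=> //; lia.
  move=> /(_ T); apply.
    have kJ := rideal_jpow R k.+2.
    apply/ridealP; split=> [t m _|x y Tx Ty t m km|x u Tx t m km].
    - by rewrite mul0r component0; case: kJ.
    - rewrite mulrBl componentB; case: kJ => _ B _.
      by apply: B; [exact: Tx|exact: Ty].
    - by rewrite -mulrA; exact: Tx.
  move=> x [i [xi i0 id]] t m km; rewrite (componentMl _ _ xi).
  apply: sub_span; exists x, (comp t (m - i)); split=> //.
    by apply: gJ xi _ => i00; rewrite i00 in i0.
  apply: IH; [exact: component_homog|nia].
have [k Jk] := jacobson_nilpotent artR.
exists (k * d)%N => j r rj kj.
by apply: Jk; apply: jpowS; exact: deep kj.
Qed.

(** Right modules have their scalars in the converse ring, so the degree zero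
    part of the grading is read as a subset of it. *)
Definition deg0 : {pred R^c} := g 0.

(** A substructure [U] of [R_j] is the trace on [R_j] of a right ideal: the
    largest one whose component of degree [j] is contained in [U]. *)
Lemma homog_finlen j :
  finlen (V := (R^c)^o) deg0 [set 0] [set x | x \in g j].
Proof.
have [rho [n rhoP]] := basic_artinian_finlen artR basicR.
pose T (U : set R) :=
  [set x : R | forall i r, r \in g (j - i) -> U (comp x i * r)].
have kT U : ksub (V := (R^c)^o) deg0 U -> rideal (T U).
  move=> kU; have [U0 UB _] := kU.
  have TD x y : T U x -> T U y -> T U (x + y).
    move=> Tx Ty i r ri; rewrite componentD mulrDl.
    by apply: (ksubD kU); [exact: Tx|exact: Ty].
  have T0 : T U 0 by move=> i r _; rewrite component0 mul0r.
  apply/ridealP; split=> // [x y Tx Ty|x t Tx].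
    by move=> i r ri; rewrite componentB mulrBl; apply: (UB);
      [exact: Tx|exact: Ty].
  elim/(homog_ind (g := g)): t => [|t u IHt IHu|k t tk].
  - by rewrite mulr0.
  - by rewrite mulrDr; exact: TD.
  - move=> i r ri; rewrite (componentMr _ _ tk) -mulrA; apply: Tx.
    have -> : j - (i - k) = k + (j - i) by lia.
    exact: homogM.
have Tin U x : ksub (V := (R^c)^o) deg0 U -> x \in g j -> U x -> T U x.
  move=> [U0 _ UZ] xj Ux i r; rewrite (component_id _ xj).
  case: eqP => [->|_]; last by rewrite mul0r.
  by rewrite subrr => r0; exact: (UZ (r : R^c) x r0 Ux).
exists (fun U => rho (T U)), n => U U' kU kU' _ UU' U'j.
have [||||//|rle rn req] := rhoP (T U) (T U').
- exact: kT.
- exact: kT.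
- by move=> _ ->; case: (kT _ kU).
- by move=> x Tx i r ri; apply: UU'; exact: Tx.
split=> // /req sub x U'x; have xj := U'j _ U'x.
have /(_ j 1) := sub _ (Tin _ _ kU' xj U'x).
by rewrite (component_id _ xj) eqxx mulr1 subrr; apply; exact: homog1.
Qed.

End GradedRing.

(** * Pieces of finite length *)

Lemma finlen_window (A : pzRingType) (K : {pred A}) (V : lmodType A)
    (c : int -> V -> V) (a : int) (L : nat) :
  (forall n, klin K (c n)) ->
  (forall n m x, c n (c m x) = if n == m then c n x else 0) ->
  (forall x, (forall n, c n x = 0) -> x = 0) ->
  (forall n, finlen K [set 0] [set x | c n x = x]) ->
  finlen K [set 0] [set x | forall n, ~~ (a <= n < a + L%:Z) -> c n x = 0].
Proof.
move=> lc cc sep flc.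
have fix_c n : ksub K [set x | c n x = x].
  have [cD cZ] := lc n.
  split=> [|x y /= cx cy|k x kK /= cx]; first exact: (add0f cD).
    by rewrite (addBf _ _ cD) cx cy.
  by rewrite cZ// cx.
have win l : ksub K [set x | forall n, ~~ (a <= n < a + l%:Z) -> c n x = 0].
  split=> [n _|x y cx cy n nl|k x kK cx n nl].
  - exact: (add0f (proj1 (lc n))).
  - by rewrite (addBf _ _ (proj1 (lc n))) cx// cy// subrr.
  - by rewrite (proj2 (lc n))// cx// scaler0.
elim: L => [|L IH].
  exists (fun=> 0%N), 0%N => U U' kU kU' _ _ U'W; split=> // _ x U'x.
  rewrite (sep x); first by case: kU.
  by move=> n; apply: (U'W _ U'x); lia.
apply: finlen_sub (finlen_sum (win L) (fix_c (a + L%:Z)) IH (flc _)) => //.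
move=> x Wx; exists (x - c (a + L%:Z) x); last first.
  by rewrite /= subKr cc eqxx.
move=> n nL; rewrite (addBf _ _ (proj1 (lc n))) cc.
case: eqP => [->|nLE]; first by rewrite subrr.
rewrite subr0; apply: Wx; lia.
Qed.

Section FinitelyGenerated.
Variables (R : pzRingType) (g : grading R) (N : lmodType R^c).
Hypotheses (artR : right_artinian R) (basicR : basic R).

Lemma ring_finlen0 : finlen (V := (R^c)^o) (deg0 g) [set 0] setT.
Proof.
have [s gs] := grading_finite_support g artR basicR.
apply: finlen_sub (@finlen_window R^c (deg0 g) (R^c)^o (fun n x =>
  component g x n)
  (- s%:Z) (s + s).+1 _ _ _ _) => //.
- move=> x _ n ns; apply: (gs n); first exact: component_homog.
  lia.
- move=> n; split=> [x y|a x aK]; first exact: (componentD g x y n).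
  by have := @componentMr R g x a 0 n aK; rewrite subr0.
- move=> n m x; rewrite (component_id _ (component_homog g x m)).
  by case: eqP => [->|].
- by move=> x x0; apply: (component_ext (g := g)) => n; rewrite x0 component0.
- move=> n; apply: finlen_sub (@homog_finlen R g artR basicR n) => // x /= <-.
  exact: component_homog.
Qed.

(** A finitely generated module is a finite sum of images of the ring, which is
    itself the sum of finitely many homogeneous components, each of finite
    length over the degree zero part. *)
Lemma fg_finlen0 : finitely_generated N -> finlen (deg0 g) [set 0] [set: N].
Proof.
move=> [s sN].
pose img (a : N) := [set y : N | exists2 r : R,
  [set: R] r & y = (r : R^c) *: a].
have ka a : @klin R^c predT (R^c)^o N (fun r : R => (r : R^c) *: a).
  split=> [x y|r x _]; first exact: scalerDl.
  exact/esym/scalerA.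
have kimg a : ksub predT (img a) by exact: (ksub_image (ka a) (@ksubT R^c predT
  (R^c)^o)).
have sub0 : {subset deg0 g <= predT} by [].
pose G := fix G (s : seq N) : set N :=
  if s is a :: s' then sumset (img a) (G s') else [set 0].
have kG l : ksub predT (G l).
  by elim: l => [|a l IH]; [exact: ksub0|exact: ksub_sumset].
have flG l : finlen (deg0 g) [set 0] (G l).
  elim: l => [|a l IH].
    by exists (fun=> 0%N), 0%N => U U' [U0 _ _] _ _ _ U'0; split=>
      // _ x /U'0 ->.
  apply: finlen_sum (ksub_weak sub0 (kimg a)) (ksub_weak sub0 (kG l)) _ IH =>
    //.
  apply: (@finlen_image R^c (deg0 g) (R^c)^o N (fun r : R =>
    (r : R^c) *: a) setT)
    ring_finlen0 => //.
  by have [kD kZ] := ka a; split=> // r x _; exact: kZ.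
apply: finlen_sub (flG s) => // x _.
have /generatedP/(_ (fun y => `[< G s y >])) : x \in generated [in s].
  by rewrite sN.
move=> /(_ _ _)/asboolP; apply.
  apply/submod_ksub; have [G0 GB GZ] := kG s.
  split=> [|u v /asboolP Gu /asboolP Gv|a u aK /asboolP Gu]; apply/asboolP=> //.
    exact: GB.
  exact: GZ.
move=> y /= ys; apply/asboolP; elim: s ys {sN flG} => // a l IH.
rewrite inE => /orP[/eqP ->|/IH]; last exact: sumsetr.
by apply: (sumsetl (kG l)); exists 1; rewrite ?scale1r.
Qed.

End FinitelyGenerated.

(** * Direct sums and quotients *)

Lemma choice_fun (T U : Type) (P : T -> U -> Prop) :
  (forall x, exists y, P x y) -> exists f, forall x, P x (f x).
Proof. by move=> /choice[f fP]; exists f. Qed.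

Section DirectSums.
Variables (V : zmodType).
Implicit Types (f h : dsum int V).

Lemma dsumDE f h n : (f + h) n = f n + h n. Proof. by []. Qed.

Lemma dsumBE f h n : (f - h) n = f n - h n. Proof. by []. Qed.

Lemma dsum_sumE (L : nat) (F : 'I_L -> dsum int V) n :
  (\sum_(i < L) F i) n = \sum_(i < L) F i n.
Proof. by apply: (big_morph (fun f : dsum int V => f n)). Qed.

Lemma singleE (n m : int) (x : V) : single n x m = if m == n then x else 0.
Proof. by []. Qed.

Lemma single_add n : additive_map (@single V n).
Proof.
by move=> x y; apply: dsumP => m; rewrite dsumDE !singleE; case: eqP => // _;
  rewrite addr0.
Qed.

Lemma mk_dsum (F : int -> V) :
  (exists q : nat, forall n, (q < `|n|)%N -> F n = 0) ->
  exists f, forall n, f n = F n.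
Proof.
move=> [q Fq].
pose near0 : seq int := map (fun i : nat => i%:Z - q%:Z) (iota 0 (q + q).+1).
have finF : F \in @finsupp_pred int V.
  apply/finsupp_predP.
  apply: (@sub_finite_set _ _ [set` near0]); last exact: finite_seq.
  move=> /= n Fn; have nq : ~ (q < `|n|)%N by move=> /Fq.
  apply/mapP; exists `|(n + q%:Z)%R|%N; last lia.
  rewrite mem_iota; lia.
by exists (Dsum finF).
Qed.

Lemma sum_pick (F : int -> V) (a n : int) (L : nat) :
  \sum_(i < L) (if n == a + i%:Z then F (a + i%:Z) else 0) =
  if a <= n < a + L%:Z then F n else 0.
Proof.
case: ifP => nL; last first.
  apply: big1 => i _; case: eqP => // nE; have := ltn_ord i; lia.
have lt_i : (`|(n - a)%R| < L)%N by lia.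
have nE : n = a + `|(n - a)%R|%:Z by lia.
rewrite (bigD1 (Ordinal lt_i))//= -nE eqxx big1 ?addr0// => i iN.
case: eqP => // nE'; exfalso; move/eqP: iN; apply; apply: val_inj => /=; lia.
Qed.

Lemma dsum_window f (a : int) (L : nat) :
  (forall n, ~~ (a <= n < a + L%:Z) -> f n = 0) ->
  f = \sum_(i < L) single (a + i%:Z) (f (a + i%:Z)).
Proof.
move=> fL; apply: dsumP => n.
rewrite dsum_sumE (eq_bigr (fun i : 'I_L =>
  if n == a + i%:Z then f (a + i%:Z) else 0))// sum_pick.
by case: ifPn => // /fL.
Qed.

Lemma dsum_bounded_window f : exists q : nat,
  forall n, ~~ (- q%:Z <= n < - q%:Z + (q + q).+1%:Z) -> f n = 0.
Proof. by have [q fq] := dsum_bounded f; exists q => n nq; apply: fq; lia. Qed.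

Lemma dsum_ind (P : dsum int V -> Prop) f : P 0 ->
  (forall h h', P h -> P h' -> P (h + h')) ->
  (forall n, P (single n (f n))) -> P f.
Proof.
move=> P0 PD Pf; have [q fq] := dsum_bounded_window f.
by rewrite (dsum_window fq); apply: big_ind.
Qed.

Definition tot f : V := \sum_(n \in [set: int]) f n.

Lemma tot_add : additive_map tot.
Proof. by move=> f h; rewrite /tot -fsumD//; exact: dsum_finite. Qed.

Lemma tot_single n x : tot (single n x) = x.
Proof.
by rewrite /tot (@fsum_only _ _ n) ?singleE ?eqxx// => i /negbTE;
  rewrite singleE => ->.
Qed.

Lemma tot_window f (a : int) (L : nat) :
  (forall n, ~~ (a <= n < a + L%:Z) -> f n = 0) ->
  tot f = \sum_(i < L) f (a + i%:Z).
Proof.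
move=> /dsum_window {1}->; rewrite (add_sumf _ tot_add).
by apply: eq_bigr => i _; rewrite tot_single.
Qed.

End DirectSums.

Section Quotients.
Variables (A : pzRingType) (M : lmodType A) (S : {pred M}).

Definition quo (x : M) : quotient_by S := \pi_(quotient_by S) x.

Lemma quo_lin : lin quo.
Proof. by split=> [x y|a x]; [exact: quotient_piD|exact/esym/quotient_scaleE].
  Qed.

Lemma quo_surj (x : quotient_by S) : exists u, x = quo u.
Proof. exact: quotient_pi_surj. Qed.

Lemma quo_repr (x : quotient_by S) : quo (repr x) = x.
Proof. exact: reprK. Qed.

Lemma quo_eq0 x : quo x = 0 <-> x \in generated S.
Proof.
have q0 : quo 0 = 0 by exact: add0f (proj1 quo_lin).
rewrite -{1}q0 -{2}[x]subr0; split=> [h|h]; exact/quotient_piP.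
Qed.

Lemma quo_descend (V : lmodType A) (k : M -> V) : lin k ->
  (forall x, x \in generated S -> k x = 0) ->
  exists kq : quotient_by S -> V, lin kq /\ forall x, kq (quo x) = k x.
Proof.
move=> [kD kZ] k0.
have kq x : k (repr (quo x)) = k x.
  apply/eqP; rewrite -subr_eq0 -(addBf _ _ kD) k0//.
  by apply/quotient_piP; exact: quo_repr.
exists (fun x => k (repr x)); split=> //; split=> [x y|a x].
  have [[u ->] [v ->]] := (quo_surj x, quo_surj y).
  by rewrite -(proj1 quo_lin) !kq kD.
by have [u ->] := quo_surj x; rewrite -(proj2 quo_lin) !kq kZ.
Qed.

End Quotients.

(** * Gradings by projections *)

Section GradedModules.
Variables (R : pzRingType) (g : grading R).

(** Gradings are encoded by the projections onto the homogeneous components,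
    which are easier to transport along maps than the components. *)
Record graded_by (V : lmodType R^c) (c : int -> V -> V) : Prop := GradedBy {
  gr_add : forall n, additive_map (c n);
  gr_orth : forall n m x, c n (c m x) = if n == m then c n x else 0;
  gr_act : forall n j (r : R) x, r \in g j ->
    c (n + j) ((r : R^c) *: x) = (r : R^c) *: c n x;
  gr_sep : forall x, (forall n, c n x = 0) -> x = 0;
  gr_bnd : forall x, exists q : nat, forall n, (q < `|n|)%N -> c n x = 0 }.

Section Theory.
Variables (V : lmodType R^c) (c : int -> V -> V) (gc : graded_by c).

Lemma gr_ext x y : (forall n, c n x = c n y) -> x = y.
Proof.
move=> xy; apply/eqP; rewrite -subr_eq0; apply/eqP/(gr_sep gc) => n.
by rewrite (addBf _ _ (gr_add gc n)) xy subrr.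
Qed.

Lemma gr_act_shift m j (r : R) x : r \in g j ->
  c m ((r : R^c) *: x) = (r : R^c) *: c (m - j) x.
Proof. by move=> rj; rewrite -(gr_act gc (m - j) x rj) subrK. Qed.

Lemma gr_klin n : klin (deg0 g) (c n).
Proof.
split=> [|a x a0]; first exact: (gr_add gc).
have := @gr_act_shift n 0 a x a0; by rewrite subr0.
Qed.

Lemma gr_id n x : c n (c n x) = c n x.
Proof. by rewrite (gr_orth gc) eqxx. Qed.

Lemma lin_from_homog (U : lmodType R^c) (f : U -> V) : additive_map f ->
  (forall j (r : R) x, r \in g j -> f ((r : R^c) *: x) = (r : R^c) *: f x) ->
  lin f.
Proof.
move=> fD fg; split=> // a x; elim/(homog_ind (g := g)): a =>
  [|r t IHr IHt|k r rk].
- by rewrite !scale0r (add0f fD).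
- by rewrite !scalerDl fD IHr IHt.
- exact: fg rk.
Qed.

(** The degree zero part of [t] is the sum of the [c n \o t \o c n]; only
    finitely many of them are nonzero as the image of [t] is bounded. *)
Lemma degree0_part (t : V -> V) : lin t ->
  (exists q : nat, forall x n, (q < `|n|)%N -> c n (t x) = 0) ->
  exists u, lin u /\ forall n x, c n (u x) = c n (t (c n x)).
Proof.
move=> [tD tZ] [q tq].
pose u x := \sum_(i < (q + q).+1)
  c (- q%:Z + i%:Z) (t (c (- q%:Z + i%:Z) x)).
have cu n x : c n (u x) = c n (t (c n x)).
  rewrite /u (add_sumf _ (gr_add gc n)).
  rewrite (eq_bigr (fun i : 'I_(q + q).+1 => if n == - q%:Z + i%:Z
    then c (- q%:Z + i%:Z) (t (c (- q%:Z + i%:Z) x)) else 0)); last first.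
    by move=> i _; rewrite (gr_orth gc); case: eqP => [->|].
  rewrite (sum_pick (fun m => c m (t (c m x)))); case: ifP => // nq.
  rewrite tq//; lia.
exists u; split=> //; apply: lin_from_homog => [x y|j r x rj]; apply: gr_ext =>
  n.
  by rewrite (gr_add gc) !cu !(gr_add gc) tD (gr_add gc).
by rewrite cu !(gr_act_shift _ _ rj) cu tZ (gr_act_shift _ _ rj).
Qed.

End Theory.

(** Graded direct summands living in finitely many degrees, encoded by their
    idempotents; [k] is the idempotent of an ambient summand. *)
Record bidem (V : lmodType R^c) (c : int -> V -> V) (k e : V -> V) : Prop :=
  Bidem {
  bi_lin : lin e;
  bi_idem : forall x, e (e x) = e x;
  bi_deg : forall n x, c n (e x) = e (c n x);
  bi_l : forall x, k (e x) = e x;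
  bi_r : forall x, e (k x) = e x;
  bi_bnd : exists q : nat, forall x n, (q < `|n|)%N -> c n (e x) = 0 }.

Definition bounded_degrees (V : lmodType R^c) (c : int -> V -> V) (a : int)
  (L : nat) : set V := [set x | forall n, ~~ (a <= n < a + L%:Z) -> c n x = 0].

Lemma ksub_bounded_degrees (V : lmodType R^c) (c : int -> V -> V) a L :
  graded_by c -> ksub (deg0 g) (bounded_degrees c a L).
Proof.
move=> gc; split=> [n _|x y cx cy n nl|k x kK cx n nl].
- exact: add0f (gr_add gc n).
- by rewrite (addBf _ _ (gr_add gc n)) cx// cy// subrr.
- by rewrite (proj2 (gr_klin gc n))// cx// scaler0.
Qed.

Section PullUpGrading.
Variables (N : lmodType R^c).
Local Notation pN := (pullup g N).

Definition pcomp (n : int) (f : pN) : pN := single n (f n).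

Lemma pullup_act (f : pN) n j (r : R) : r \in g j ->
  ((r : R^c) *: f) n = (r : R^c) *: f (n - j).
Proof. exact: pullup_fun_homog. Qed.

Lemma pcompE n (f : pN) m : pcomp n f m = if m == n then f n else 0.
Proof. exact: singleE. Qed.

Lemma graded_pullup : graded_by pcomp.
Proof.
split.
- by move=> n f h; exact: single_add.
- move=> n m f; apply: dsumP => k; rewrite pcompE pcompE.
  case: (eqVneq n m) => [<-|nm]; first by [].
  by rewrite if_same.
- move=> n j r f rj; apply: dsumP => k.
  rewrite (pullup_act _ _ rj) !pcompE (pullup_act _ _ rj) addrK subr_eq.
  by case: eqP => //; rewrite scaler0.
- move=> f f0; apply: dsumP => n.
  by have : pcomp n f n = (0 : pN) n by [rewrite f0]; rewrite pcompE eqxx.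
- move=> f; have [q fq] := dsum_bounded f; exists q => n nq.
  by apply: dsumP => k; rewrite pcompE fq// if_same.
Qed.

Lemma tot_lin : lin (fun f : pN => tot f : N).
Proof.
have tD : additive_map (fun f : pN => tot f : N) by exact: tot_add.
split=> // a f; elim/(homog_ind (g := g)): a => [|r t IHr IHt|j r rj].
- by rewrite !scale0r (add0f tD).
- by rewrite !scalerDl -IHr -IHt; exact: tD.
apply: (@dsum_ind N (fun f => tot ((r : R^c) *: (f : pN) : pN) =
  (r : R^c) *: (tot f : N)) f) => [|{}f h IHf IHh|n].
- by rewrite scaler0 (add0f tD) scaler0.
- by rewrite scalerDr [LHS]tD IHf IHh -scalerDr; congr (_ *: _); exact/esym/tD.
- by rewrite (pullup_singleE _ _ rj) !tot_single.
Qed.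

(** Every [N e_n] is a copy of [N] over the degree zero part of the ring. *)
Lemma single_klin n : klin (deg0 g) (fun x : N => single n x : pN).
Proof.
split=> [|a x a0]; first exact: single_add.
by rewrite (pullup_singleE n x (a0 : (a : R) \in g 0)) addr0.
Qed.

Lemma pullup_map (k : N -> N) : lin k ->
  exists k' : pN -> pN, lin k' /\ forall f n, k' f n = k (f n).
Proof.
move=> [kD kZ].
have [k' k'E] : exists k' : pN -> pN, forall f n, k' f n = k (f n).
  apply: (@choice_fun pN pN (fun f h => forall n, h n = k (f n))) => f.
  apply: (@mk_dsum N (fun n => k (f n))).
  have [q fq] := dsum_bounded f.
  by exists q => n /fq ->; exact: add0f.
exists k'; split=> //; apply: lin_from_homog => [f h|j r f rj]; apply: dsumP =>
  n.
  by rewrite dsumDE !k'E dsumDE kD.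
by rewrite (pullup_act _ _ rj) !k'E (pullup_act _ _ rj) kZ.
Qed.

Local Notation P := (pruefer g N).
Local Notation q := (@quo R^c pN (@pullup_neg R g N)).

Lemma relations_graded (f : pN) n :
  f \in generated (@pullup_neg R g N) -> pcomp n f \in generated (@pullup_neg R
    g N).
Proof.
set Q := generated _ => fQ.
have kQ := (submod_ksub Q).1 (generated_submod_closed _).
have gp := graded_pullup.
pose U : {pred pN} := fun f => `[< forall n, pcomp n f \in Q >].
suff /asboolP : f \in U by exact.
move/generatedP: fQ; apply.
  apply/submod_ksub; split=> [|u v /asboolP Uu /asboolP Uv|a u _ /asboolP Uu];
    apply/asboolP => m.
  - by rewrite (add0f (gr_add gp m)); case: kQ.
  - rewrite (addBf _ _ (gr_add gp m)); case: kQ => _ QB _.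
    by apply: QB; [exact: Uu|exact: Uv].
  - elim/(homog_ind (g := g)): a => [|r t IHr IHt|j r rj].
    + by rewrite scale0r (add0f (gr_add gp m)); case: kQ.
    + by rewrite scalerDl (gr_add gp); exact: (ksubD kQ).
    + rewrite (gr_act_shift gp _ _ rj); case: kQ => _ _ QZ.
      exact: (QZ _ _ isT (Uu _)).
move=> u /asboolP u0; apply/asboolP => m; apply/generatedP => W _; apply.
apply/asboolP => i i0; rewrite pcompE; case: eqP => // im.
by rewrite -im u0.
Qed.

Variables (s : nat).
Hypothesis gs : forall j r, r \in g j -> (s < `|j|)%N -> r = 0.

Lemma relations_bounded (f : pN) n :
  f \in generated (@pullup_neg R g N) -> s%:Z <= n -> f n = 0.
Proof.
move=> fQ sn.
pose U : {pred pN} := fun f => `[< forall n j (r : R), r \in g j ->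
  s%:Z <= n + j -> (r : R^c) *: f n = 0 >].
suff /asboolP/(_ n 0 1 (homog1 g)) : f \in U.
  by rewrite addr0 scale1r; exact.
move/generatedP: fQ; apply.
  apply/submod_ksub; split=> [|u v /asboolP Uu /asboolP Uv|a u _ /asboolP Uu];
    apply/asboolP => m j r rj mj.
  - exact: scaler0.
  - by rewrite dsumBE scalerBr (Uu _ _ _ rj)// (Uv _ _ _ rj)// subrr.
  - elim/(homog_ind (g := g)): a => [|t t' IHr IHt|k t tk].
    + by rewrite scale0r scaler0.
    + by rewrite scalerDl dsumDE scalerDr IHr IHt addr0.
    + rewrite (pullup_act _ _ tk) scalerA.
      by apply: (Uu (m - k) (k + j)); [exact: homogM|lia].
move=> u /asboolP u0; apply/asboolP => m j r rj mj.
have [m0|m0] := leP 0 m; first by rewrite u0// scaler0.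
by rewrite (gs rj) ?scale0r//; lia.
Qed.

Definition qcomp (n : int) (x : P) : P := q (pcomp n (repr x)).

Lemma qcompE n f : qcomp n (q f) = q (pcomp n f).
Proof.
rewrite /qcomp; apply/eqP; rewrite -subr_eq0 -(addBf _ _ (proj1 (quo_lin _))).
rewrite -(addBf _ _ (gr_add graded_pullup n)); apply/eqP/quo_eq0.
by apply: relations_graded; apply/quotient_piP; exact: quo_repr.
Qed.

Lemma graded_pruefer : graded_by qcomp.
Proof.
have [qD qZ] := quo_lin (@pullup_neg R g N); have gp := graded_pullup.
split.
- move=> n x y; have [[u ->] [v ->]] := (quo_surj x, quo_surj y).
  by rewrite -qD !qcompE (gr_add gp) qD.
- move=> n m x; have [u ->] := quo_surj x; rewrite !qcompE (gr_orth gp).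
  by case: eqP => _; [exact: qcompE|exact: (add0f qD)].
- move=> n j r x rj; have [u ->] := quo_surj x.
  by rewrite -qZ !qcompE (gr_act gp _ _ rj) qZ.
- move=> x; have [u ->] := quo_surj x => u0; apply/quo_eq0.
  have kQ := (submod_ksub _).1 (generated_submod_closed (@pullup_neg R g N)).
  apply: (@dsum_ind N (fun f => f \in generated (@pullup_neg R g N)) u).
  + by case: kQ.
  + by move=> f h; exact: (ksubD kQ).
  + by move=> n; have := u0 n; rewrite qcompE => /quo_eq0.
- move=> x; have [u ->] := quo_surj x; have [b ub] := gr_bnd gp u.
  by exists b => n nb; rewrite qcompE ub//; exact: (add0f qD).
Qed.

Lemma qcomp_neg n x : n < 0 -> qcomp n x = 0.
Proof.
move=> n0; have [u ->] := quo_surj x; rewrite qcompE; apply/quo_eq0.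
apply/generatedP => U _; apply; apply/asboolP => i i0; rewrite pcompE.
by case: eqP => // iE; lia.
Qed.

Hypothesis flN : finlen (deg0 g) [set 0] [set: N].

Lemma pullup_bounded_finlen a L :
  finlen (deg0 g) [set 0] (bounded_degrees pcomp a L).
Proof.
have gp := graded_pullup; apply: finlen_window.
- exact: gr_klin gp.
- exact: gr_orth gp.
- exact: gr_sep gp.
- move=> n; apply: finlen_image (single_klin n) (ksubT _ _) _ flN.
  by move=> f fE; exists (f n).
Qed.

Lemma pruefer_bounded_finlen a L :
  finlen (deg0 g) [set 0] (bounded_degrees qcomp a L).
Proof.
have gq := graded_pruefer; have [qD qZ] := quo_lin (@pullup_neg R g N).
apply: finlen_window.
- exact: gr_klin gq.
- exact: gr_orth gq.
- exact: gr_sep gq.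
- move=> n; apply: (@finlen_image _ _ _ _ (fun x : N =>
    q (single n x)) setT) flN.
  + have [sD sZ] := single_klin n; split=> [x y|a' x a0];
      first by rewrite sD qD.
    by rewrite sZ// qZ.
  + exact: ksubT.
  + by move=> x /= <-; exists (repr x n).
Qed.

End PullUpGrading.

End GradedModules.

(** * Bounded graded summands of graded modules of finite type *)

Section Retract.
Variables (A : pzRingType).

Lemma finite_type_retract (P : lmodType A) : finite_type P ->
  exists X : lmodType A, finite_length X /\ exists (I : Type)
    (f : P -> dsum I X) (h : dsum I X -> P), [/\ lin f, lin h &
    forall x, h (f x) = x].
Proof.
move=> [X [flX [I [f [finj [cU [W [cW UW UWT]]]]]]]].
exists X; split=> //; exists I, f.
have kU := (submod_ksub _).1 cU; have kW := (submod_ksub _).1 cW.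
have ex y : exists x, y - f x \in W.
  have [u [v [/asboolP[x ->] Wv ->]]] := UWT y.
  by exists x; rewrite addrC addKr.
have [h hW] := choice_fun ex.
have uniq x x' y : y - f x \in W -> y - f x' \in W -> x = x'.
  move=> Wx Wx'; apply: finj; apply/eqP; rewrite -subr_eq0; apply/eqP/UW.
    by apply/asboolP; exists (x - x'); rewrite raddfB.
  have -> : f x - f x' = (y - f x') - (y - f x) by rewrite opprB [RHS]addrC
    addrA subrK.
  by case: kW => _ B _; exact: B.
exists h; split; [exact: lin_linear| |].
  split=> [y y'|a y]; apply: uniq (hW _) _.
    by rewrite linearD opprD addrACA; apply: (ksubD kW); exact: hW.
  by rewrite linearZ -scalerBr; case: kW => _ _ Z; exact: (Z _ _ isT (hW _)).
move=> x; apply: uniq (hW _) _; rewrite subrr; by case: kW.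
Qed.

Variables (I : Type) (X : lmodType A).

Lemma isum_single (i : I) : exists e : X -> dsum I X, lin e /\
  forall x j, e x j = if `[< j = i >] then x else 0.
Proof.
have [e eE] : exists e : X -> dsum I X,
    forall x j, e x j = if `[< j = i >] then x else 0.
  apply: (@choice_fun X (dsum I X) (fun x y => forall j,
    y j = if `[< j = i >] then x else 0)) => x.
  have fin : (fun j => if `[< j = i >] then x else 0) \in @finsupp_pred I X.
    apply/finsupp_predP; apply: (@sub_finite_set _ _ [set i]); last first.
      exact: finite_set1.
    by move=> j /=; case: asboolP.
  by exists (Dsum fin).
exists e; split=> //; split=> [x y|a x]; apply: dsumP => j.
  by rewrite [RHS](_ : _ = e x j + e y j)// !eE; case: ifP => //; rewrite addr0.
by rewrite [RHS](_ : _ = a *: e x j)// !eE; case: ifP => //; rewrite scaler0.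
Qed.

Lemma isum_restrict (J : set I) : exists e : dsum I X -> dsum I X, lin e /\
  forall y j, e y j = if `[< J j >] then y j else 0.
Proof.
have [e eE] : exists e : dsum I X -> dsum I X,
    forall y j, e y j = if `[< J j >] then y j else 0.
  apply: (@choice_fun (dsum I X) (dsum I X) (fun x y => forall j,
    y j = if `[< J j >] then x j else 0)) => y.
  have fin : (fun j => if `[< J j >] then y j else 0) \in @finsupp_pred I X.
    have /finsupp_predP fy : dsum_fun y \in @finsupp_pred I X by exact: (valP
      y).
    apply/finsupp_predP; apply: sub_finite_set fy => j /=.
    by case: ifP.
  by exists (Dsum fin).
exists e; split=> //; split=> [x y|a x]; apply: dsumP => j.
  by rewrite [RHS](_ : _ = e x j + e y j)// !eE; case: ifP => //; rewrite addr0.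
by rewrite [RHS](_ : _ = a *: e x j)// !eE; case: ifP => //; rewrite scaler0.
Qed.

End Retract.

Section Bounded.
Variables (R : pzRingType) (g : grading R) (s : nat).
Hypothesis gs : forall j r, r \in g j -> (s < `|j|)%N -> r = 0.
Variables (V : lmodType R^c) (c : int -> V -> V) (gc : graded_by g c).

(** As the ring has bounded degrees, so has the submodule generated by an
    element, and one climbs along a composition series. *)
Lemma finite_length_bounded (X : lmodType R^c) (t : X -> V) :
  finite_length X -> lin t ->
  exists q : nat, forall x n, (q < `|n|)%N -> c n (t x) = 0.
Proof.
move=> [l [U [cU U0 Ul Umax]]] [tD tZ].
have cyc (x : X) : exists q : nat, forall (a : R^c) n, (q < `|n|)%N ->
    c n (t (a *: x)) = 0.
  have [q tq] := gr_bnd gc (t x); exists (q + s)%N => a n nq; rewrite tZ.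
  elim/(homog_ind (g := g)): a => [|r r' IHr IHr'|j r rj].
  - by rewrite scale0r; exact: add0f (gr_add gc n).
  - by rewrite scalerDl (gr_add gc) IHr IHr' addr0.
  - rewrite (gr_act_shift gc _ _ rj); have [js|js] := leqP `|j|%N s.
      by rewrite tq ?scaler0//; lia.
    by rewrite (gs rj js) scale0r.
suff: forall i, (i <= l)%N ->
    exists q : nat, forall x n, x \in U i -> (q < `|n|)%N -> c n (t x) = 0.
  by move=> /(_ l (leqnn l))[q tq]; exists q => x n; apply: tq; rewrite Ul.
elim=> [|i IH] il.
  exists 0%N => x n; rewrite U0 inE => /eqP -> _.
  by rewrite (add0f tD) (add0f (gr_add gc n)).
have [q tq] := IH (ltnW il).
have [UU UnU Um] := Umax _ il.
have [x0 Ux0 UNx0] : exists2 x0, x0 \in U i.+1 & x0 \notin U i.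
  apply: contrapT => h; apply: UnU => x Ux; apply/negPn/negP => UNx.
  by apply: h; exists x.
have [q0 tq0] := cyc x0.
have kU := (submod_ksub _).1 (cU i); have kU' := (submod_ksub _).1 (cU i.+1).
pose W : {pred X} := fun x => `[< exists u a, u \in U i /\ x = u + a *: x0 >].
have cW : submod_closed W.
  apply/submod_ksub; split=>
    [|x y /asboolP[u [a [Uu ->]]] /asboolP[v [b [Uv ->]]]
    |a x _ /asboolP[u [b [Uu ->]]]]; apply/asboolP.
  - by exists 0, 0; split; [case: kU|rewrite scale0r addr0].
  - exists (u - v), (a - b); split; first by case: kU => _ B _; exact: B.
    by rewrite scalerBl opprD addrACA.
  - exists (a *: u), (a * b); split; first by case: kU => _ _ Z; exact: Z.
    by rewrite scalerDr scalerA.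
have x0W : x0 \in W.
  by apply/asboolP; exists 0, 1; split; [case: kU|rewrite scale1r add0r].
have [||WU|WU] := Um W cW.
- by move=> x Ux; apply/asboolP; exists x, 0; rewrite scale0r addr0.
- move=> x /asboolP[u [a [Uu ->]]]; apply: (ksubD kU'); first exact: UU.
  by case: kU' => _ _ Z; exact: Z.
- by rewrite -WU x0W in UNx0.
exists (q + q0)%N => x n; rewrite -WU => /asboolP[u [a [Uu ->]]] nq.
by rewrite tD (gr_add gc) tq ?tq0 ?addr0//; lia.
Qed.

Lemma finite_support_bounded (I : Type) (X : lmodType R^c) (t : dsum I X -> V)
  (J : set I) : finite_length X -> lin t -> finite_set J ->
  exists q : nat, forall (y : dsum I X) n, (forall i, y i <> 0 -> J i) ->
    (q < `|n|)%N -> c n (t y) = 0.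
Proof.
move=> flX [tD tZ] /(@finite_seqP {classic I})[l JE].
suff [q tq] : exists q : nat, forall (y : dsum I X) n,
    (forall i, y i <> 0 -> (i : {classic I}) \in l) ->
    (q < `|n|)%N -> c n (t y) = 0.
  exists q => y n yJ; apply: tq => i /yJ; by rewrite JE.
elim: l {JE} => [|a l [q IH]].
  exists 0%N => y n y0 _; have -> : y = 0.
    by apply: dsumP => i; apply: contrapT => /y0.
  by rewrite (add0f tD) (add0f (gr_add gc n)).
have [e [le eE]] := isum_single X (a : I).
have [q' tq'] := finite_length_bounded flX (lin_comp (conj tD tZ) le).
exists (q + q')%N => y n yl nq; rewrite -[y](subrK (e (y a))) tD (gr_add gc).
rewrite [X in _ + X]tq' ?addr0; last lia.
apply: IH; last lia.
move=> i; rewrite (_ : (y - e (y a)) i = y i - e (y a) i)// eE.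
case: asboolP => [->|ia]; first by rewrite subrr.
rewrite subr0 => /yl; rewrite inE => /orP[/eqP|//]; exact.
Qed.

Lemma bidem0 (k : V -> V) : lin k -> bidem c k (fun=> 0).
Proof.
move=> [kD _]; split=> //.
- by split=> [x y|a x]; rewrite ?addr0 ?scaler0.
- by move=> n _; exact: add0f (gr_add gc n).
- by move=> _; exact: (add0f kD).
- by exists 0%N => _ n _; exact: add0f (gr_add gc n).
Qed.

Hypothesis flV : forall a L, finlen (deg0 g) [set 0] (bounded_degrees c a L).

(** If [V] has finite type, the identity is, on any given element, a map that
    factors through a finite sum of copies of a module of finite length; so its
    degree zero part has bounded image and fixes any given homogeneous element.
    By Fitting's lemma this yields bounded graded summands.  If [V] lives in
    nonnegative degrees, splitting off such summands until the complement is as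
    small as possible in degrees below [L] leaves a complement whose bounded
    graded summands live in degrees at least [L]. *)
Lemma high_summand (k : V -> V) (L : nat) :
  finite_type V -> (forall n x, n < 0 -> c n x = 0) ->
  lin k -> (forall x, k (k x) = k x) -> (forall n x, c n (k x) = k (c n x)) ->
  (forall m, exists n x, [/\ m <= n, c n x = x, k x = x & x <> 0]) ->
  exists e, [/\ bidem c k e, forall n x, n < L%:Z -> e (c n x) = 0 &
    exists x, e x <> 0].
Proof.
move=> ftV cneg lk kk ck high; have [kD kZ] := lk.
have [X [flX [I [f [h [lf lh hf]]]]]] := finite_type_retract ftV.
pose low := bounded_degrees c 0 L.
have klow : ksub (deg0 g) low by exact: ksub_bounded_degrees.
pose T (e : V -> V) := [set y | exists2 x, low x & y = k x - e x].
have lke e : bidem c k e -> lin (fun x => k x - e x).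
  by move=> be; apply: lin_sub => //; exact: bi_lin be.
have Tlow e : bidem c k e -> T e `<=` low.
  move=> be _ [x xl ->] n nL; rewrite (addBf _ _ (gr_add gc n)) ck (bi_deg be).
  by rewrite xl// (add0f kD) (add0f (proj1 (bi_lin be))) subrr.
have kT e : bidem c k e -> ksub (deg0 g) (T e).
  move=> be; have := ksub_image (lin_klin (deg0 g) (lke _ be)) klow; exact.
have [rho [l rhoP]] := flV 0 L.
have [|eta [be etamin]] := @nat_min _ (fun e => bidem c k e) (fun e =>
  rho (T e)).
  by exists (fun=> 0); exact: bidem0.
have [q etaq] := bi_bnd be; have [eD eZ] := bi_lin be.
pose k' x := k x - eta x.
have lk' : lin k' by exact: lke.
have [k'D k'Z] := lk'.
have k'k' x : k' (k' x) = k' x.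
  rewrite /k' (addBf _ _ kD) (addBf _ _ eD) kk (bi_l be) (bi_r be) (bi_idem be).
  by rewrite subrr subr0.
have kk' x : k (k' x) = k' x by rewrite /k' (addBf _ _ kD) kk (bi_l be).
have k'k x : k' (k x) = k' x by rewrite /k' kk (bi_r be).
have ek' x : eta (k' x) = 0.
  by rewrite /k' (addBf _ _ eD) (bi_r be) (bi_idem be) subrr.
have ck' n x : c n (k' x) = k' (c n x).
  by rewrite /k' (addBf _ _ (gr_add gc n)) ck (bi_deg be).
have [n [x [qn cx kx x0]]] := high q.+1%:Z.
have k'x : k' x = x.
  rewrite /k' kx (_ : eta x = 0) ?subr0// -cx -(bi_deg be) etaq//; lia.
(* E keeps the finitely many copies of X in which x has a component *)
have [E [lE EE]] := isum_restrict X [set i | f x i <> 0].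
have Efx : E (f x) = f x.
  by apply: dsumP => i; rewrite EE; case: asboolP => //= /contrapT.
have bndt : exists q : nat, forall y m, (q < `|m|)%N -> c m (h (E (f y))) = 0.
  have [|b hb] := @finite_support_bounded I X h [set i | f x i <> 0] flX lh.
    by apply/finsupp_predP; exact: (valP (f x)).
  exists b => y m; apply: hb => i; rewrite EE; by case: asboolP.
have [u [lu uE]] := degree0_part gc (lin_comp lh (lin_comp lE lf)) bndt.
have [b tb] := bndt.
have cu m y : c m (u y) = u (c m y).
  apply: (gr_ext gc) => m'; rewrite (gr_orth gc) !uE (gr_orth gc).
  case: eqP => [//|_].
  by rewrite (add0f (proj1 (lin_comp lh (lin_comp lE lf)))) (add0f (gr_add gc
    m')).
have ux : u x = x.
  rewrite -cx -cu uE cx /= Efx hf cx//.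
pose v y := k' (u (k' y)).
have lv : lin v by apply: lin_comp lk' (lin_comp lu lk').
have cv m y : c m (v y) = v (c m y) by rewrite /v ck' cu ck'.
have vx : v x = x by rewrite /v k'x ux.
have vbnd y m : (b < `|m|)%N -> c m (v y) = 0.
  move=> mb; rewrite /v ck' uE (tb _ _ mb); exact: (add0f k'D).
pose W := bounded_degrees c (- b%:Z) (b + b).+1.
have vW y : W (v y) by move=> m mb; apply: vbnd; lia.
have [e [le ee ev evc [efix _ _ _]]] :=
  fitting (ksub_bounded_degrees _ _ gc) (flV _ _) lv vW.
have [e_D e_Z] := le.
have k'e y : k' (e y) = e y by have [w ->] := ev y; exact: k'k'.
have ce m y : c m (e y) = e (c m y).
  by apply: evc => [|w]; [right; exact: gr_klin|rewrite cv].
have k'v w : k' (v w) = v (k' w) by rewrite /v !k'k'.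
have ek'e y : e (k' y) = e y by rewrite -(evc _ (or_introl lk') k'v) k'e.
have bie : bidem c k e.
  split=> //.
  - by move=> y; rewrite -k'e kk'.
  - by move=> y; rewrite -ek'e k'k ek'e.
  - exists b => y m mb; have [w ->] := ev y; exact: vbnd.
have ete y : eta (e y) = 0 by rewrite -k'e ek'.
have eet y : e (eta y) = 0.
  rewrite -ek'e /k' (bi_l be) (bi_idem be) subrr; exact: (add0f e_D).
exists e; split=> //; last by exists x; rewrite efix.
pose eta' y := eta y + e y.
have be' : bidem c k eta'.
  have le' : lin eta' by apply: lin_add => //; exact: bi_lin be.
  split=> //.
  - by move=> y; rewrite /eta' eD e_D (bi_idem be) ee ete eet addr0 add0r.
  - by move=> m y; rewrite /eta' (gr_add gc) (bi_deg be) ce.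
  - by move=> y; rewrite /eta' kD (bi_l be) (bi_l bie).
  - by move=> y; rewrite /eta' (bi_r be) (bi_r bie).
  - exists (q + b)%N => y m mqb; have [b' _] := bi_bnd bie.
    rewrite (gr_add gc) etaq ?add0r; last lia.
    have [w ->] := ev y; apply: vbnd; lia.
have TT : T eta' `<=` T eta.
  move=> _ [y yl ->]; exists (y - e y).
    by move=> m mL; rewrite (addBf _ _ (gr_add gc m)) ce yl// (add0f e_D) subrr.
  rewrite -[RHS]/(k' (y - e y)) (addBf _ _ k'D) k'e /k' /eta'.
  by rewrite opprD addrA.
(* by minimality, adding e to eta does not shrink the complement in low degrees *)
have ekill y : low y -> e y = 0.
  move=> yl.
  have [//|||||_ _ sub] := rhoP (T eta') (T eta).
  - exact: kT.
  - exact: kT.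
  - by move=> _ ->; case: (kT _ be').
  - by [].
  - exact: Tlow.
  have [z zl yz] := sub (etamin _ be') (k' y) (ex_intro2 _ _ y yl erefl).
  rewrite -ek'e yz /eta' (addBf _ _ e_D) e_D (bi_r bie) eet ee add0r.
  by rewrite subrr.
move=> m y mL; apply: ekill => m' m'L; rewrite (gr_orth gc).
case: eqP => // m'm; apply: cneg; lia.
Qed.

End Bounded.

(** * From a graded summand of the pull-up to a graded summand of the module *)

Section Step.
Variables (R : pzRingType) (g : grading R) (s : nat).
Hypothesis gs : forall j r, r \in g j -> (s < `|j|)%N -> r = 0.
Variables (N : lmodType R^c).
Hypothesis flN : finlen (deg0 g) [set 0] [set: N].
Local Notation pN := (pullup g N).
Local Notation c := (@pcomp R g N).
Let gc : graded_by g c := graded_pullup g N.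

(** In degrees at least [s] the pull-up and the Pruefer module agree, and an
    element of degrees at least [2 s] generates a submodule in degrees at least
    [s]; so a summand in degrees at least [2 s] lifts. *)
Lemma lift_summand (k : N -> N) : lin k -> (forall x, k (k x) = k x) ->
  (exists x, k x <> 0) -> finite_type (pruefer g N) ->
  exists (k' e : pN -> pN), [/\ forall f n, k' f n = k (f n),
    bidem c k' e & exists f, e f <> 0].
Proof.
move=> lk kk [v0 kv0] ftP; have [kD kZ] := lk.
have [k' [lk' k'E]] := pullup_map g lk; have [k'D k'Z] := lk'.
have ck' n f : c n (k' f) = k' (c n f).
  apply: dsumP => m; rewrite !pcompE !k'E pcompE.
  by case: eqP => // _; exact/esym/(add0f kD).
have k'k' f : k' (k' f) = k' f by apply: dsumP => n; rewrite !k'E kk.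
pose Q := generated (@pullup_neg R g N).
pose q := @quo R^c pN (@pullup_neg R g N).
have lq : lin q by exact: quo_lin.
have [qD qZ] := lq.
have gq := graded_pruefer g N.
have k'Q f : f \in Q -> q (k' f) = 0.
  move=> /generatedP fQ; apply/quo_eq0.
  pose U : {pred pN} := fun f => k' f \in Q.
  apply: (fQ U).
    apply/submod_ksub.
    apply: (ksub_preim (lin_klin predT lk') (U := [set f | f \in Q])).
    by apply/submod_ksub; exact: generated_submod_closed.
  move=> u /asboolP u0; apply/generatedP => W _; apply.
  by apply/asboolP => i i0; rewrite k'E u0// (add0f kD).
have [kP [lkP kPE]] := quo_descend (lin_comp lq lk') k'Q.
have [kPD kPZ] := lkP.
have ckP n x : qcomp n (kP x) = kP (qcomp n x).
  by have [f ->] := quo_surj x; rewrite kPE /= !qcompE kPE /= ck'.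
have kPkP x : kP (kP x) = kP x.
  by have [f ->] := quo_surj x; rewrite kPE /= [LHS]kPE /= k'k'.
pose L := (s + s)%N.
have high0 f n : q f = 0 -> s%:Z <= n -> f n = 0.
  by move=> /quo_eq0 fQ; exact: (relations_bounded gs fQ).
have [] := @high_summand R g s gs _ _ gq (pruefer_bounded_finlen flN) kP L ftP.
- exact: qcomp_neg.
- exact: lkP.
- exact: kPkP.
- exact: ckP.
- move=> m; pose n : int := (`|m| + s)%N%:Z.
  exists n, (q (single n (k v0))); split.
  + by rewrite /n; lia.
  + by rewrite [LHS]qcompE; congr q; apply: dsumP => i;
      rewrite pcompE !singleE eqxx.
  + rewrite [LHS]kPE; congr q; apply: dsumP => i; rewrite k'E !singleE.
    by case: eqP => _; [exact: kk|exact: (add0f kD)].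
  + move=> /high0/(_ (_ : s%:Z <= n)); rewrite singleE eqxx => h.
    by apply: kv0; apply: h; rewrite /n; lia.
move=> e [be elow [x0 ex0]].
have [eD eZ] := bi_lin be.
have qc n f : q (c n f) = qcomp n (q f) by exact/esym/qcompE.
have kq h : q (k' h) = kP (q h) by exact/esym/kPE.
have lift f : exists u : pN, (forall n, n < s%:Z -> u n = 0) /\ q u = e (q f).
  have [u uE] : exists u : dsum int N, forall n,
      u n = if s%:Z <= n then repr (e (q f)) n else 0.
    apply: (@mk_dsum N (fun n => if s%:Z <= n then repr (e (q f)) n else 0)).
    have [b hb] := dsum_bounded (repr (e (q f))).
    by exists b => n /hb ->; rewrite if_same.
  exists u; split=> [n ns|]; first by rewrite uE leNgt ns.
  apply: (gr_ext gq) => n; rewrite -qc; have [sn|ns] := leP s%:Z n.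
    rewrite -[e (q f)]quo_repr [RHS]qcompE; congr q; apply: dsumP => i.
    by rewrite !pcompE uE sn.
  rewrite (bi_deg be) (elow n); last by rewrite /L; lia.
  rewrite -[RHS](add0f qD); congr q; apply: dsumP => i.
  by rewrite pcompE uE leNgt ns if_same.
have uniq (u u' : pN) : (forall n, n < s%:Z -> u n = 0) ->
    (forall n, n < s%:Z -> u' n = 0) -> q u = q u' -> u = u'.
  move=> us u's qu; apply: dsumP => n; have [sn|ns] := leP s%:Z n.
    apply/eqP; rewrite -subr_eq0 -dsumBE; apply/eqP/high0 => //.
    by rewrite (addBf _ _ qD) qu subrr.
  by rewrite us// u's.
have [e' e'P] := choice_fun lift.
have e's f n : n < s%:Z -> e' f n = 0 by exact: (proj1 (e'P f)).
have qe' f : q (e' f) = e (q f) by exact: (proj2 (e'P f)).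
have e'L f n : n < L%:Z -> e' f n = 0.
  move=> nL; have [sn|] := leP s%:Z n; last exact: e's.
  suff /high0/(_ sn) : q (c n (e' f)) = 0 by rewrite pcompE eqxx.
  by rewrite qc qe' (bi_deg be) elow.
exists k', e'; split=> //; last first.
  have [f fE] := quo_surj x0; exists f => e'f; apply: ex0.
  by rewrite fE -[LHS]qe' e'f (add0f qD).
split.
- apply: (lin_from_homog (g := g)) => [f h|j r f rj]; apply: uniq.
  + exact: e's.
  + by move=> n ns; rewrite dsumDE !e's// addr0.
  + by rewrite qe' qD eD qD !qe'.
  + exact: e's.
  + move=> n ns; rewrite (pullup_act _ _ rj); have [js|js] := leqP `|j|%N s.
      by rewrite e'L ?scaler0// /L; lia.
    by rewrite (gs rj js) scale0r.
  + by rewrite qe' qZ eZ qZ qe'.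
- move=> f; apply: uniq; [exact: e's|exact: e's|].
  by rewrite !qe' (bi_idem be).
- move=> n f; apply: uniq; [|exact: e's|].
    by move=> m ms; rewrite pcompE; case: eqP => // mn; rewrite -mn e's.
  by rewrite qc !qe' qc (bi_deg be).
- move=> f; apply: uniq; [|exact: e's|].
    by move=> m ms; rewrite k'E e's// (add0f kD).
  by rewrite kq qe' (bi_l be).
- move=> f; apply: uniq; [exact: e's|exact: e's|].
  by rewrite !qe' kq (bi_r be).
- have [b eb] := bi_bnd be; exists b => f n nb; apply: dsumP => m.
  rewrite pcompE; case: eqP => // _; have [sn|] := leP s%:Z n; last exact: e's.
  suff /high0/(_ sn) : q (c n (e' f)) = 0 by rewrite pcompE eqxx.
  by rewrite qc qe' eb.
Qed.

(** Let the bounded idempotent [e] be minimal, with image [Z].  The map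
    [a : Z -> N -> Z] composed of the sum of the coordinates and of
    [x |-> \sum_n e (x e_n)] is the sum of the maps [e \phi^d e], where [\phi]
    is the shift.  For [d = 0] this is the identity of [Z]; the others are
    nilpotent, as [Z] is bounded.  By minimality the homogeneous nilpotent
    endomorphisms of [Z] form a semigroup, so that [a - 1] is nilpotent by
    Levitzki's theorem and [a] is bijective.  Hence the ungraded module [Z] is a
    summand of [N]; the map [z] is the projection. *)
Lemma summand_of_pullup (k : N -> N) (k' e0 : pN -> pN) :
  lin k -> (forall f n, k' f n = k (f n)) ->
  bidem c k' e0 -> (exists f, e0 f <> 0) ->
  exists z : N -> pN, [/\ lin z, forall x n, k (z x n) = z x n,
    forall x, z (k x) = z x,
    forall x n, z (tot (c n (z x))) = c n (z x) &
    (exists q : nat, forall x n, (q < `|n|)%N -> z x n = 0) /\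
    exists x, z x <> 0].
Proof.
move=> [kD kZ] k'E be0 [f0 e0f0].
have [q q0] := bi_bnd be0.
pose W := bounded_degrees c (- q%:Z) (q + q).+1.
have kW : ksub (deg0 g) W by exact: ksub_bounded_degrees.
have flW : finlen (deg0 g) [set 0] W by exact: pullup_bounded_finlen.
have W0 f : W f -> forall n, (q < `|n|)%N -> f n = 0.
  move=> Wf n nq; suff : c n f n = (0 : pN) n by rewrite pcompE eqxx.
  rewrite Wf//; lia.
have inW (f : pN) : (forall n, (q < `|n|)%N -> f n = 0) -> W f.
  move=> fq n nq; apply: dsumP => m; rewrite pcompE fq ?if_same//; lia.
have [rho [l rhoP]] := flW.
pose Im (e : pN -> pN) := [set y | exists x, y = e x].
pose good e := [/\ bidem c k' e, exists f, e f <> 0 & Im e `<=` W].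
have [|e [[be [f1 ef1] eW] emin]] := @nat_min _ good (fun e => rho (Im e)).
  exists e0; split=> //; first by exists f0.
  by move=> _ [x ->] n nq; apply: q0; lia.
have le := bi_lin be; have [eD eZ] := le; have ee := bi_idem be.
have {}eW f : W (e f) by apply: eW; exists f.
have kIm h : lin h -> ksub (deg0 g) (Im h).
  move=> lh; have := ksub_image (lin_klin (deg0 g) lh) (ksubT _ _).
  by rewrite (_ : [set y | _] = Im h)//; apply/seteqP; split=>
    [y [x _ ->]|y [x ->]];
    exists x.
(* otherwise Fitting's idempotent would have a smaller nonzero image *)
have local h : lin h -> (forall f, e (h f) = h f) -> (forall f,
  h (e f) = h f) ->
    (forall n f, c n (h f) = h (c n f)) ->
    (exists i, forall f, W f -> iter i h f = 0) \/ Im e `<=` Im h.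
  move=> lh eh he ch.
  have [|t [lt tt th tc [_ _ [i tnil] _]]] := fitting kW flW lh.
    by move=> f; rewrite -eh; exact: eW.
  have [t0|tn0] := pselect (forall f, t f = 0).
    by left; exists i => f _; exact: tnil.
  right; have et f : e (t f) = t f by have [y ->] := th f; exact: eh.
  have te f : t (e f) = t f.
    by rewrite -(tc _ (or_introl le)) ?et// => w; rewrite he eh.
  have gt : good t.
    split; last by move=> _ [x ->]; rewrite -et; exact: eW.
      split=> //.
      - move=> n f; apply: tc => [|w]; [right; exact: gr_klin gc n|].
        by rewrite ch.
      - by move=> f; rewrite -et (bi_l be).
      - by move=> f; rewrite -te (bi_r be) te.
      - exists q => f n nq; rewrite -et; apply: eW; lia.
    apply: contrapT => h0; apply: tn0 => f; apply: contrapT => tf.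
    by apply: h0; exists f.
  have [//|||||_ _ sub] := rhoP (Im t) (Im e).
  - exact: kIm.
  - exact: kIm.
  - by move=> _ ->; case: (kIm _ lt).
  - by move=> _ [x ->]; exists (t x).
  - by move=> _ [x ->]; exact: eW.
  by move=> y /(sub (emin _ gt))[x ->]; have [w ->] := th x; exists w.
pose homogeneous (t : pN -> pN) (d : int) :=
  forall n f, c (n + d) (t f) = t (c n f).
pose S (t : pN -> pN) := [/\ lin t, forall f, e (t f) = t f,
  forall f, t (e f) = t f, exists d, homogeneous t d &
  exists i, forall f, W f -> iter i t f = 0].
have shift_nil t d : lin t -> (forall f, e (t f) = t f) -> homogeneous t d ->
    d <> 0 -> exists i, forall f, W f -> iter i t f = 0.
  move=> lt et td d0; exists (q + q).+1 => f Wf; apply: (gr_sep gc) => n.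
  have itE i m : c m (iter i t f) = iter i t (c (m - d *+ i) f).
    elim: i m => [|i IH] m; first by rewrite mulr0n subr0.
    rewrite iterS -[m](subrK d) td IH /=; congr (t (iter i t (c _ f))).
    by rewrite subrK mulrS opprD addrA.
  have [nq|nq] := leqP `|n|%N q; last first.
    apply: dsumP => m; rewrite pcompE; case: eqP => // _.
    by rewrite iterS -et (W0 _ (eW _)).
  rewrite itE Wf ?(add0f (proj1 (lin_iter _ lt)))//.
  rewrite -mulr_natr; nia.
have SS t u : S t -> S u -> S (t \o u).
  move=> [lt et te [d td] [i ti]] [lu eu ue [d' ud] ui].
  have ltu : lin (t \o u) by exact: lin_comp.
  have tud : homogeneous (t \o u) (d' + d).
    by move=> n f; rewrite addrA td ud.
  have etu f : e ((t \o u) f) = (t \o u) f by exact: et.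
  have tue f : (t \o u) (e f) = (t \o u) f by rewrite /= ue.
  split=> //; first by exists (d' + d).
  have [dd|dd] := pselect (d' + d = 0); last exact: shift_nil tud dd.
  have [|//|sub] := local _ ltu etu tue.
    by move=> n f; have := tud n f; rewrite dd addr0.
  (* t would be surjective on Z, hence so would be its powers *)
  exfalso; apply: ef1.
  suff h j f : exists f', e f = iter j t (e f').
    by have [f' ->] := h i f1; rewrite ti.
  elim: j f => [|j IH] f; first by exists f.
  have [w ->] := sub _ (ex_intro _ f erefl).
  have [f' ewf'] := IH (u w); exists f'.
  by rewrite iterS -ewf' eu.
have [||||k0 Wk0] := @levitzki _ (deg0 g) pN S W kW flW.
- by move=> t [].
- exact: SS.
- by move=> t f [_ et _ _ _] _; rewrite -et; exact: eW.
- by move=> t [].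
pose en n (x : N) : N := e (single n x : pN) n.
have eE f n : e f n = en n (f n).
  have : c n (e f) n = e (c n f) n by rewrite (bi_deg be).
  by rewrite pcompE eqxx.
have enD n : additive_map (en n).
  by move=> x y; rewrite /en (single_add n x y) eD.
have en0 n x : (q < `|n|)%N -> en n x = 0 by move=> nq;
  rewrite /en (W0 _ (eW _)).
have [pi piE] : exists pi : N -> pN, forall x n, pi x n = en n x.
  apply: (@choice_fun N pN (fun x f => forall n, f n = en n x)) => x.
  by apply: (@mk_dsum N (fun n => en n x)); exists q => n; exact: en0.
have lpi : lin pi.
  apply: (lin_from_homog (g := g)) => [x y|j r x rj]; apply: dsumP => n.
    by rewrite dsumDE !piE enD.
  rewrite (pullup_act _ _ rj) !piE /en.
  have := pullup_singleE (n - j) x rj; rewrite subrK => <-.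
  by rewrite eZ (pullup_act _ _ rj).
have epi x : e (pi x) = pi x.
  apply: dsumP => n; rewrite eE !piE /en.
  by have := ee (single n x : pN); move/(congr1 (fun f : pN => f n));
    rewrite eE.
have ltot := tot_lin g N; have [totD totZ] := ltot.
pose a (f : pN) : pN := pi (tot (e f)).
have la : lin a by exact: lin_comp lpi (lin_comp ltot le).
have ea f : e (a f) = a f by exact: epi.
(* [sh] is the shift \phi; the sum of the e \phi^d e is finite since e \phi^d e
   vanishes unless |d| <= 2 q *)
have [sh shE] : exists sh : int -> pN -> pN, forall d f n, sh d f n = f (n - d).
  suff: forall df : int * pN, exists h : pN, forall n, h n = df.2 (n - df.1).
    by move=> /choice_fun[h hE]; exists (fun d f => h (d, f)) => d f n;
      rewrite hE.
  move=> [d f]; apply: (@mk_dsum N (fun n => f (n - d))).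
  have [b fb] := dsum_bounded f; exists (b + `|d|)%N => n nb; apply: fb; lia.
have lsh d : lin (sh d).
  apply: (lin_from_homog (g := g)) => [f h|j r f rj]; apply: dsumP => n.
    by rewrite dsumDE !shE.
  by rewrite (pullup_act _ _ rj) !shE (pullup_act _ _ rj) addrAC.
have Ssh d : d <> 0 -> S (fun f => e (sh d (e f))).
  move=> d0.
  have lt : lin (fun f => e (sh d (e f))) by exact: lin_comp le (lin_comp (lsh
    d) le).
  have td : homogeneous (fun f => e (sh d (e f))) d.
    move=> n f; rewrite (bi_deg be); congr e; apply: dsumP => m.
    by rewrite -(bi_deg be) shE !pcompE shE addrK subr_eq.
  split=> //; first by move=> f; rewrite ee.
  - by exists d.
  - by apply: shift_nil td d0 => // f; rewrite ee.
have aE f : e f = f -> a f = \sum_(i < (4 * q).+1) e (sh ((2 * q)%N%:Z - i%:Z)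
  f).
  move=> ef; apply: dsumP => n; rewrite dsum_sumE piE ef.
  have [nq|nq] := leqP `|n|%N q; last first.
    rewrite en0// big1// => i _; exact: W0 (eW _) _ nq.
  have fq := W0 f; rewrite -{1}ef in fq; have {}fq := fq (eW _).
  rewrite (@tot_window _ f (n - (2 * q)%N%:Z) (4 * q).+1); last first.
    by move=> m mq; apply: fq; lia.
  rewrite (add_sumf _ (enD n)); apply: eq_bigr => i _.
  by rewrite eE shE opprB addrA addrAC.
have a_inj f : e f = f -> a f = 0 -> f = 0.
  move=> ef af.
  have step i : killed_by S i.+1 f -> killed_by S i f.
    move=> Sf; have kk : ksub (deg0 g) (killed_by S i).
      by apply: ksub_killed_by => t [].
    have lt0 : (2 * q < (4 * q).+1)%N by lia.
    have := aE _ ef; rewrite af (bigD1 (Ordinal lt0))//= subrr.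
    have -> : e (sh 0 f) = f.
      rewrite -[RHS]ef; congr e; apply: dsumP => n; by rewrite shE subr0.
    move/esym/eqP; rewrite addr_eq0 => /eqP ->; apply: (ksubN kk).
    apply: big_ind => [|x y|j jq]; first by case: kk.
      exact: (ksubD kk).
    have d0 : (2 * q)%N%:Z - j%:Z <> 0.
      by move=> dj; move/eqP: jq; apply; apply: val_inj => /=; lia.
    by have := Sf _ (Ssh _ d0); rewrite /= ef.
  have : killed_by S k0 f by apply: Wk0; rewrite -ef; exact: eW.
  by elim: (k0) => [//|i IH] /step.
(* by finite length of Z, injectivity of a is enough *)
have fixW : ksub (deg0 g) [set f | e f = f].
  split=> [|x y /= ex ey|r x _ /= ex]; first exact: (add0f eD).
    by rewrite (addBf _ _ eD) ex ey.
  by rewrite eZ ex.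
have a_surj f : e f = f -> exists f', e f' = f' /\ a f' = f.
  move=> ef.
  have [|//|t [_ _ th _ [_ _ _ tid]]] := fitting fixW _ la.
    by apply: finlen_sub flW => // x /= <-; exact: eW.
  have [y] := th f; rewrite (tid a_inj _ ef) => fE.
  by exists (e y); split; [exact: ee|rewrite /a ee -/(a y)].
have exz x : exists f, e f = f /\ a f = pi x by apply: a_surj; exact: epi.
have [z zP] := choice_fun exz.
have uniq f f' : e f = f -> e f' = f' -> a f = a f' -> f = f'.
  move=> ef ef' aff'; apply/eqP; rewrite -subr_eq0; apply/eqP/a_inj.
    by rewrite (addBf _ _ eD) ef ef'.
  by rewrite (addBf _ _ (proj1 la)) aff' subrr.
have ez x : e (z x) = z x by exact: (proj1 (zP x)).
have az x : a (z x) = pi x by exact: (proj2 (zP x)).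
have ztot f : e f = f -> z (tot f) = f.
  by move=> ef; apply: uniq => //; rewrite az /a ef.
have [aD aZ] := la; have [piD piZ] := lpi.
exists z; split.
- split=> [x y|r x]; apply: uniq => //.
  + by rewrite eD !ez.
  + by rewrite aD !az piD.
  + by rewrite eZ ez.
  + by rewrite aZ !az piZ.
- by move=> x n; rewrite -k'E -[in LHS]ez (bi_l be) ez.
- move=> x; apply: uniq => //; rewrite !az; apply: dsumP => n; rewrite !piE /en.
  rewrite -[in RHS](bi_r be); congr (e _ n); apply: dsumP => m.
  by rewrite k'E !singleE; case: eqP => // _; exact/esym/(add0f kD).
- by move=> x n; apply: ztot; rewrite -(bi_deg be) ez.
split; first by exists q => x n nq; rewrite -ez (W0 _ (eW _)).
by exists (tot (e f1)); rewrite ztot ?ee.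
Qed.

(** As for gradings, graded direct summands are encoded by the projections onto
    their homogeneous components; [k] projects onto the complement. *)
Record graded_summand (d : int -> N -> N) (k : N -> N) : Prop := GradedSummand {
  gs_add : forall n, additive_map (d n);
  gs_orth : forall n m x, d n (d m x) = if n == m then d n x else 0;
  gs_act : forall n j (r : R) x, r \in g j ->
    d (n + j) ((r : R^c) *: x) = (r : R^c) *: d n x;
  gs_bnd : exists q : nat, forall x n, (q < `|n|)%N -> d n x = 0;
  gs_lin : lin k;
  gs_idem : forall x, k (k x) = k x;
  gs_l : forall n x, k (d n x) = 0;
  gs_r : forall n x, d n (k x) = 0;
  gs_full : forall x, (forall n, d n x = 0) -> k x = x }.

(** As long as the complement [k N] of a graded summand of [N] is nonzero, the
    two preceding lemmas split a nonzero graded summand off it; so a smallest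
    such complement vanishes. *)
Lemma pruefer_finite_type_graded : finite_type (pruefer g N) ->
  exists d : int -> N -> N, graded_by g d.
Proof.
move=> ftP; have [rho [l rhoP]] := flN.
pose Im (k : N -> N) := [set y | exists x, y = k x].
pose good (dk : (int -> N -> N) * (N -> N)) := graded_summand dk.1 dk.2.
have kIm k : lin k -> ksub (deg0 g) (Im k).
  move=> lk; have := ksub_image (lin_klin (deg0 g) lk) (ksubT _ _).
  by rewrite (_ : [set y | _] = Im k)//; apply/seteqP; split=>
    [y [x _ ->]|y [x ->]];
    exists x.
have [|[d k] [/= gd dmin]] := @nat_min _ good (fun dk => rho (Im dk.2)).
  exists (fun _ _ => 0, id); split=> //=.
  - by move=> n x y; rewrite addr0.
  - by move=> n m x; rewrite if_same.
  - by move=> n j r x _; rewrite scaler0.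
  - by exists 0%N.
have {}gd : graded_summand d k := gd.
exists d; have [kD kZ] := gs_lin gd.
have [k0|] := pselect (forall x, k x = 0).
  split; [exact: gs_add gd|exact: gs_orth gd|exact: gs_act gd| |].
    by move=> x /(gs_full gd); rewrite k0.
  by move=> x; have [q dq] := gs_bnd gd; exists q => n; exact: dq.
move=> /existsNP[x0 kx0]; exfalso.
have [k' [e [k'E be e0]]] := lift_summand (gs_lin gd) (gs_idem gd)
  (ex_intro _ x0 kx0) ftP.
have [z [lz kz zk zz [[q zq] [x1 zx1]]]] :=
  summand_of_pullup (gs_lin gd) k'E be e0.
have [zD zZ] := lz; have [tD tZ] := tot_lin g N.
pose p x := tot (z x).
have lp : lin p by exact: lin_comp (tot_lin g N) lz.
have ztot x : z (p x) = z x.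
  have zW n : ~~ (- q%:Z <= n < - q%:Z + (q + q).+1%:Z) -> z x n = 0.
    by move=> nq; apply: zq; lia.
  rewrite [RHS](dsum_window zW) /p (tot_window zW) (add_sumf _ zD).
  by apply: eq_bigr => i _; rewrite -[RHS]zz tot_single.
have kp x : k (p x) = p x.
  rewrite /p (@tot_window _ (z x) (- q%:Z) (q + q).+1); last first.
    by move=> n nq; apply: zq; lia.
  by rewrite (add_sumf _ kD); apply: eq_bigr => i _; rewrite kz.
have pk x : p (k x) = p x by rewrite /p zk.
have pp x : p (p x) = p x by rewrite /p -/(p x) ztot.
have [pD pZ] := lp.
have zc x n m : z (z x m) n = if n == m then z x m else 0.
  have <- : tot (c m (z x)) = z x m by exact: tot_single.
  by rewrite zz pcompE; case: eqP => // _; exact/esym/tot_single.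
have dz n x m : d n (z x m) = 0 by rewrite -kz (gs_r gd).
have zd n x : z (d n x) = 0 by rewrite -zk (gs_l gd) (add0f zD).
have dp n x : d n (p x) = 0 by rewrite -kp (gs_r gd).
have pd n x : p (d n x) = 0 by rewrite /p zd (add0f tD).
pose d' n x := d n x + z x n; pose k2 x := k x - p x.
have gd' : graded_summand d' k2.
  split.
  - by move=> n x y; rewrite /d' (gs_add gd) zD dsumDE addrACA.
  - move=> n m x; rewrite /d' (gs_add gd) zD dsumDE zd dz zc (gs_orth gd).
    rewrite addr0 [X in _ + (X + _)](_ : _ = 0)// add0r.
    by case: eqP => [->|_] //; rewrite addr0.
  - move=> n j r x rj; rewrite /d' (gs_act gd _ _ rj) zZ (pullup_act _ _ rj)
      addrK.
    by rewrite scalerDr.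
  - have [b db] := gs_bnd gd; exists (b + q)%N => x n nb.
    by rewrite /d' db ?zq ?addr0//; lia.
  - exact: lin_sub (gs_lin gd) lp.
  - move=> x; rewrite /k2 (addBf _ _ kD) (addBf _ _ pD) (gs_idem gd) kp pk pp.
    by rewrite subrr subr0.
  - move=> n x; rewrite /k2 /d' kD pD (gs_l gd) pd kz !add0r.
    rewrite /p (_ : z (z x n) = c n (z x)) ?tot_single ?subrr//.
    by apply: dsumP => m; rewrite zc pcompE.
  - move=> n x; rewrite /k2 /d' (addBf _ _ (gs_add gd n)) (addBf _ _ zD) (gs_r
      gd) dp.
    by rewrite dsumBE zk ztot !subrr addr0.
  - move=> x xd.
    have dx n : d n x = 0.
      have := congr1 (d n) (xd n); rewrite /d' (gs_add gd) dz (gs_orth gd) eqxx.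
      by rewrite addr0 (add0f (gs_add gd n)).
    have zx : z x = 0.
      by apply: dsumP => n; have := xd n; rewrite /d' dx add0r.
    by rewrite /k2 /p zx (add0f tD) subr0; exact: gs_full gd _ dx.
have [//|||||_ _ sub] := rhoP (Im k2) (Im k).
- exact: kIm (gs_lin gd').
- exact: kIm (gs_lin gd).
- by move=> _ ->; case: (kIm _ (gs_lin gd')).
- by move=> _ [x ->]; exists (x - p x); rewrite (addBf _ _ kD) kp.
- by [].
have {}sub := sub (dmin (d', k2) gd').
apply: zx1; rewrite -ztot -kp.
have [w ->] := sub _ (ex_intro _ (p x1) erefl).
by rewrite /k2 (addBf _ _ zD) zk ztot subrr.
Qed.

End Step.

(** * Gradable modules *)

Section Gradable.
Variables (R : pzRingType) (g : grading R) (N : lmodType R^c).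

Lemma graded_gradable (d : int -> N -> N) : graded_by g d -> gradable g N.
Proof.
move=> gd; exists N, (fun n : int => fun x : N => `[< d n x = x >]).
split; last by exists idfun; exists id.
split; last first.
  by move=> i j x r /asboolP xi rj; apply/asboolP;
    rewrite (gr_act gd _ _ rj) xi.
have dtot (f : dsum int N) m : (forall n, d n (f n) = f n) -> d m (tot f) = f m.
  move=> df; have [q fq] := dsum_bounded_window f.
  rewrite (tot_window fq) (add_sumf _ (gr_add gd m)).
  rewrite (eq_bigr (fun i : 'I_(q + q).+1 => if m == - q%:Z + i%:Z
    then f (- q%:Z + i%:Z) else 0)); last first.
    by move=> i _; rewrite -df (gr_orth gd); case: eqP => [->|].
  by rewrite sum_pick; case: ifPn => // /fq.
split=> [n|x].
  split=> [|x y /asboolP xn /asboolP yn]; apply/asboolP.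
    exact: add0f (gr_add gd n).
  by rewrite (addBf _ _ (gr_add gd n)) xn yn.
have [f fE] := mk_dsum (gr_bnd gd x).
have dff n : d n (f n) = f n by rewrite fE (gr_id gd).
exists f; split=> [|f' [f'G xE]].
  split=> [n|]; first exact/asboolP.
  by apply: (gr_ext gd) => m; rewrite [RHS]dtot// fE.
apply: dsumP => n; rewrite fE [in LHS]xE [LHS]dtot// => m.
exact/asboolP/f'G.
Qed.

Lemma gradable_graded : gradable g N -> exists d : int -> N -> N, graded_by g d.
Proof.
move=> [M [G [[[Gz Gsum] Gact] [f [h fK hK]]]]].
have [cm cmP] : exists cm : M -> dsum int M, forall x, [/\ forall n,
  cm x n \in G n,
    x = tot (cm x) & forall c' : dsum int M, (forall n, c' n \in G n) ->
      x = tot c' -> cm x = c'].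
  apply: (@choice_fun M (dsum int M) (fun x c => [/\ forall n, c n \in G n,
    x = tot c & forall c' : dsum int M, (forall n, c' n \in G n) ->
      x = tot c' -> c = c'])) => x.
  have [c [[cG xE] cu]] := Gsum x; exists c; split=> // c' c'G c'E.
  exact: cu.
have cmG x n : cm x n \in G n by have [] := cmP x.
have cmE x : tot (cm x) = x by have [_ <-] := cmP x.
have cmU x (c' : dsum int M) : (forall n,
  c' n \in G n) -> x = tot c' -> cm x = c'.
  by have [_ _] := cmP x; exact.
have cmD x y : cm (x + y) = cm x + cm y.
  apply: cmU => [n|]; first by apply: (GRing.zmod_closedD (Gz n)).2; exact: cmG.
  by rewrite tot_add !cmE.
have cm_homog n x : x \in G n -> cm x = single n x.
  move=> xG; apply: cmU; last by rewrite tot_single.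
  move=> m; rewrite singleE; case: eqP => [->//|_].
  by case: (Gz m).
have cm_act j (r : R) x n : r \in g j ->
    cm ((r : R^c) *: x) n = (r : R^c) *: cm x (n - j).
  move=> rj; rewrite -(pullup_act (cm x : pullup g M) n rj);
    congr (dsum_fun _ n).
  apply: cmU => [m|]; last by rewrite (proj2 (tot_lin g M)) cmE.
  by rewrite (pullup_act _ _ rj) -[X in G X](subrK j); exact: Gact.
have [fD fZ] := lin_linear f.
have hD x y : h (x + y) = h x + h y.
  by apply: (can_inj fK); rewrite fD !hK.
have hZ a x : h (a *: x) = a *: h x by apply: (can_inj fK); rewrite fZ !hK.
exists (fun n x => f (cm (h x) n)); split.
- by move=> n x y; rewrite hD cmD dsumDE fD.
- move=> n m x; rewrite fK (cm_homog m)// singleE; case: eqP => [->|_] //.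
  exact: add0f fD.
- by move=> n j r x rj; rewrite hZ (cm_act _ _ _ _ rj) addrK fZ.
- move=> x x0; apply: (can_inj hK); rewrite -[LHS]cmE (_ : cm (h x) = 0).
    by rewrite (add0f (@tot_add _)) -(fK 0) (add0f fD).
  by apply: dsumP => n; rewrite -[LHS]fK x0 -(add0f fD) fK.
- move=> x; have [q hq] := dsum_bounded (cm (h x)).
  by exists q => n /hq ->; exact: add0f fD.
Qed.

End Gradable.

Section CompositionSeries.
Variables (A : pzRingType) (V : lmodType A).

Lemma finlen_composition_series : finlen predT [set 0] [set: V] ->
  finite_length V.
Proof.
move=> [rho [l rhoP]].
have k0 : ksub predT [set 0 : V] by exact: ksub0.
pose above (U U' : set V) := [/\ ksub predT U', U `<=` U',
  forall W, ksub predT W -> U `<=` W -> W `<=` U' -> W `<=` U \/ U' `<=` W &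
  ~ [set: V] `<=` U -> ~ U' `<=` U].
have [nx nxP] : exists nx : set V -> set V, forall U,
  ksub predT U -> above U (nx U).
  apply: (@choice_fun _ _ (fun U U' => ksub predT U -> above U U')) => U.
  have [kU|nkU] := pselect (ksub predT U); last by exists U.
  have [UT|UT] := pselect ([set: V] `<=` U).
    by exists U => _; split=> // W _ _ WU; left.
  have [|U' [[kU' UU' U'U] U'min]] := @nat_min _ (fun U' =>
    [/\ ksub predT U', U `<=` U' & ~ U' `<=` U]) rho.
    by exists setT; split.
  exists U' => _; split=> // W kW UW WU'.
  have [WU|WU] := pselect (W `<=` U); [by left|right].
  have [//|//||//|//|_ _] := rhoP W U'; first by move=> _ ->; case: kW.
  by apply; apply: U'min; split.
pose u n := iter n nx [set 0].
have ku n : ksub predT (u n) by elim: n => // n IH; have [] := nxP _ IH.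
have rho_u n : ~ [set: V] `<=` u n -> (n <= rho (u n))%N.
  elim: n => // n IH uT; have [_ uu _ unu] := nxP _ (ku n).
  have unT : ~ [set: V] `<=` u n by move=> h; apply: uT; exact: subset_trans uu.
  apply: leq_ltn_trans (IH unT) _; rewrite ltnNge; apply/negP => le_rho.
  apply: (unu unT); have [//|//||//|//|_ _] := rhoP (u n) (u n.+1).
    by move=> _ ->; case: (ku n).
  exact.
have [|n [nT nmin]] := @nat_min nat (fun n => [set: V] `<=` u n) id.
  exists l.+1; apply: contrapT => /rho_u.
  have [//|//||//|//|_ le_l _] := rhoP (u l.+1) (u l.+1).
    by move=> _ ->; case: (ku l.+1).
  by rewrite leqNgt ltnS le_l.
exists n, (fun i x => `[< u i x >]); split.
- move=> i; apply/submod_ksub; have [u0 uB uZ] := ku i.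
  split=> [|x y /asboolP ux /asboolP uy|a x aK /asboolP ux]; apply/asboolP =>
    //.
    exact: uB.
  exact: uZ.
- by move=> x; rewrite [RHS]inE; apply/asboolP/eqP.
- by move=> x; rewrite [RHS]inE; apply/asboolP; exact: nT.
move=> i i_n; have [_ uu umax unu] := nxP _ (ku i).
have {}unu : ~ nx (u i) `<=` u i.
  by apply: unu => /nmin; rewrite /= leqNgt i_n.
split=> [x /asboolP ux|h|W cW uW Wu]; first by apply/asboolP; exact: uu.
  by apply: unu => x ux; apply/asboolP/h/asboolP.
have kW := (submod_ksub W).1 cW.
have [||Wui|uiW] := umax _ kW.
- by move=> x ux; apply: uW; apply/asboolP.
- by move=> x /Wu/asboolP.
- left=> x; apply/idP/idP => [Wx|]; last exact: uW.
  by apply/asboolP; exact: Wui.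
- right=> x; apply/idP/idP; first exact: Wu.
  by move=> /asboolP ux; exact: uiW.
Qed.

Lemma retract_finite_type (X : lmodType A) (I : Type) (f : V -> dsum I X)
    (h : dsum I X -> V) : finite_length X -> lin f -> lin h ->
  (forall x, h (f x) = x) -> finite_type V.
Proof.
move=> flX [fD fZ] lh hf; have [hD hZ] := lh.
have linf : linear f by move=> a x y; rewrite fD fZ.
pose f' : {linear V -> dsum I X} :=
  HB.pack f (GRing.isLinear.Build _ _ _ _ f linf).
exists X; split=> //; exists I, f'.
have finj : injective f by exact: can_inj hf.
split=> //; split.
  apply/submod_ksub; split=> [|_ _ /asboolP[x ->] /asboolP[y ->]
    |a _ _ /asboolP[x ->]]; apply/asboolP.
  - by exists 0; rewrite /= (add0f fD).
  - by exists (x - y); rewrite /= (addBf _ _ fD).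
  - by exists (a *: x); rewrite /= fZ.
exists (fun y => `[< h y = 0 >]); split.
- apply/submod_ksub; have := ksub_preim (lin_klin predT lh) (ksub0 _ _).
  move=> [k0 kB kZ].
  split=> [|x y /asboolP hx /asboolP hy|a x aK /asboolP hx]; apply/asboolP =>
    //.
    exact: kB.
  exact: kZ.
- by move=> _ /asboolP[x ->] /asboolP /=; rewrite hf => ->; rewrite (add0f fD).
- move=> y; exists (f (h y)), (y - f (h y)); split.
  + by apply/asboolP; exists (h y).
  + by apply/asboolP; rewrite (addBf _ _ hD) hf subrr.
  + by rewrite addrC subrK.
Qed.

End CompositionSeries.

(** * The Pruefer module of a graded module *)

Section GradedPruefer.
Variables (R : pzRingType) (g : grading R) (N : lmodType R^c).
Hypothesis flN : finlen predT [set 0] [set: N].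
Variables (d : int -> N -> N) (gd : graded_by g d).
Local Notation pN := (pullup g N).
Local Notation q := (@quo R^c pN (@pullup_neg R g N)).

Lemma tot_scale (V : lmodType R^c) (a : R^c) (f : dsum int V) :
  tot (a *: f) = a *: tot f.
Proof.
have [b fb] := dsum_bounded_window f.
rewrite (tot_window fb) (@tot_window _ (a *: f) (- b%:Z) (b + b).+1).
  by rewrite scaler_sumr.
by move=> n nb; transitivity (a *: f n) => //; rewrite fb// scaler0.
Qed.

(** In the [k]-th copy of [N] in its pull-up, these are the relations defining
    the Pruefer module. *)
Definition below (k : int) : set N :=
  span [set x | exists2 m, m < k & d m x = x].

Lemma ksub_below k : ksub predT (below k).
Proof. exact: ksub_span. Qed.

Lemma below_le k l : k <= l -> below k `<=` below l.
Proof.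
move=> kl; apply: span_min; first exact: ksub_below.
by move=> x [m mk dx]; apply: sub_span; exists m => //; exact: lt_le_trans kl.
Qed.

Lemma below_stationary : exists k0 k1 : int, k0 <= k1 /\
  forall k, below (if k < k0 then k0 else if k1 < k then k1 else k) = below k.
Proof.
have [rho [l rhoP]] := flN.
have z k : [set 0] `<=` below k by move=> _ ->; case: (ksub_below k).
have [|i [_ imin]] := @nat_min nat (fun=> True) (fun i => rho (below (- i%:Z))).
  by exists 0%N.
have [||j [_ jmax]] := @nat_max nat (fun=> True) (fun j => rho (below j%:Z)) l.
- by exists 0%N.
- move=> j _.
  by have [//|//|//|//] := rhoP _ _ (ksub_below j%:Z) (ksub_below j%:Z).
exists (- i%:Z), j%:Z; split; first lia.
move=> k; case: ifP => [ki|ki].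
  apply/seteqP; split; last by apply: below_le; lia.
  have [//||//|_ _] := rhoP _ _ (ksub_below k) (ksub_below (- i%:Z)).
    by apply: below_le; lia.
  have -> : k = - (`|k|%N)%:Z by lia.
  by apply; exact: imin.
case: ifP => [jk|//].
apply/seteqP; split; first by apply: below_le; lia.
have [//||//|_ _] := rhoP _ _ (ksub_below j%:Z) (ksub_below k).
  by apply: below_le; lia.
have -> : k = (`|k|%N)%:Z by lia.
by apply; exact: jmax.
Qed.

(** For graded [N] the pull-up is, for each integer [k], the sum of a copy of
    [N], spanned by the [N_(n + k) e_n].  Under this decomposition the relations
    defining the Pruefer module are the direct sum of the submodules [below k],
    so that it is the direct sum of the [N / below k].  By finite length there
    are only finitely many such quotients.  Their direct sum [X] is written as a
    quotient of a direct sum of copies of [N], so that all of its summands are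
    given by a single type. *)
Lemma graded_pruefer_finite_type : finite_type (pruefer g N).
Proof.
have [k0 [k1 [k01 clE]]] := below_stationary.
pose cl (k : int) := if k < k0 then k0 else if k1 < k then k1 else k.
have {}clE k : below (cl k) = below k by exact: clE.
have clk k : k0 <= cl k <= k1 by rewrite /cl; case: ifP => [|?]; [|case: ifP];
  lia.
have [qD qZ] := quo_lin (@pullup_neg R g N).
pose T : {pred dsum int N} :=
  fun h => `[< forall k, k0 <= k <= k1 -> below k (h k) >].
have kT : submod_closed T.
  apply/submod_ksub; split=> [|x y /asboolP Tx /asboolP Ty|a x _ /asboolP Tx];
    apply/asboolP => k kk; have [b0 bB bZ] := ksub_below k; first exact: b0.
    by apply: bB; [exact: Tx|exact: Ty].
  by apply: bZ => //; exact: Tx.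
have genT h : h \in generated T -> h \in T.
  by move=> /generatedP; apply.
have Tgen h : h \in T -> h \in generated T.
  by move=> hT; apply/generatedP => U _; exact.
pose X : lmodType R^c := quotient_by T.
pose p : dsum int N -> X := @quo R^c (dsum int N) T.
have lp : lin p by exact: quo_lin.
have [pD pZ] := lp.
have lsingle (V : lmodType R^c) n : lin (fun x : V => single n x).
  split=> [x y|a x]; first exact: single_add.
  apply: dsumP => m; transitivity (if m == n then a *: x else 0) => //.
  transitivity (a *: (if m == n then x else 0)) => //.
  by case: eqP => //; rewrite scaler0.
have Tsingle k x : below k x -> p (single (cl k) x) = 0.
  move=> bx; apply/quo_eq0/Tgen/asboolP => k' _; rewrite singleE.
  by case: eqP => [->|_]; [rewrite clE|case: (ksub_below k')].
have flX : finite_length X.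
  apply: finlen_composition_series.
  pose comp n (h : dsum int N) : dsum int N := single n (h n).
  pose W : set (dsum int N) :=
    [set h | forall n, ~~ (k0 <= n < k0 + `|(k1 - k0)%R|.+1%:Z) -> comp n h =
      0].
  have compK n : klin predT (comp n).
    by split=> [x y|a x _]; rewrite /comp;
      [exact: single_add|exact: (lsingle N n).2].
  have flW : finlen predT [set 0] W.
    apply: finlen_window => //.
    - move=> n m x; apply: dsumP => i; rewrite /comp !singleE.
      case: (eqVneq n m) => [<-|nm] //; by rewrite if_same.
    - move=> h h0; apply: dsumP => n.
      have : comp n h n = (0 : dsum int N) n by rewrite h0.
      by rewrite singleE eqxx.
    - move=> n; apply: (finlen_image (lin_klin predT (lsingle N n)) (ksubT _
        _)) flN.
      by move=> h hE; exists (h n).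
  have kW : ksub predT W.
    split=> [n _|x y Wx Wy n nW|a x _ Wx n nW].
    - exact: add0f (compK n).1.
    - by rewrite (addBf _ _ (compK n).1) Wx// Wy// subrr.
    - by rewrite (compK n).2// Wx// scaler0.
  apply: (finlen_image (lin_klin predT lp) kW) flW => y _.
  have [h ->] := quo_surj y.
  have [|h' h'E] := @mk_dsum N (fun n => if k0 <= n <= k1 then h n else 0).
    have [b hb] := dsum_bounded h; exists b => n /hb ->; exact: if_same.
  exists h'.
    move=> n nk; have h'n : h' n = 0 by rewrite h'E ifF//; lia.
    by apply: dsumP => m; rewrite singleE h'n if_same.
  apply/eqP; rewrite -subr_eq0 -(addBf _ _ pD); apply/eqP/quo_eq0/Tgen/asboolP.
  move=> k kk; rewrite dsumBE h'E kk subrr; by case: (ksub_below k).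
(* [tot (D k f)] is the component of [f] in the [k]-th copy of [N] *)
have [D DE] : exists D : int -> pN -> pN, forall k f n,
  D k f n = d (n + k) (f n).
  suff: forall kf : int * pN, exists h : pN, forall n,
    h n = d (n + kf.1) (kf.2 n).
    by move=> /choice_fun[h hE]; exists (fun k f => h (k, f)) => k f n;
      rewrite hE.
  move=> [k f]; apply: (@mk_dsum N (fun n => d (n + k) (f n))).
  have [b fb] := dsum_bounded f; exists b => n /fb ->.
  exact: add0f (gr_add gd _).
have DD k f h : D k (f + h) = D k f + D k h.
  by apply: dsumP => n; rewrite !(DE, dsumDE) (gr_add gd).
have Dsingle k n x : D k (single n x) = single n (d (n + k) x).
  apply: dsumP => m; rewrite DE !singleE; case: eqP => [->//|_].
  exact: add0f (gr_add gd _).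
have Dact k j (r : R) f : r \in g j -> D k ((r : R^c) *: f) = (r : R^c) *: D k
  f.
  move=> rj; apply: dsumP => n;
    rewrite (pullup_act _ _ rj) !DE (pullup_act _ _ rj).
  by rewrite (gr_act_shift gd _ _ rj) addrAC.
have [tD tZ] := tot_lin g N.
have Dbnd f : exists b : nat, forall k, (b < `|k|)%N -> tot (D k f) = 0.
  apply: (@dsum_ind N (fun f => exists b : nat, forall k, (b < `|k|)%N ->
    tot (D k f) = 0) f).
  - exists 0%N => k _; rewrite (_ : D k 0 = 0) ?(add0f tD)//.
    exact: add0f (DD k).
  - move=> h h' [b hb] [b' hb']; exists (b + b')%N => k kb.
    by rewrite DD [LHS]tD hb ?hb' ?addr0//; lia.
  - move=> n; have [b db] := gr_bnd gd (f n); exists (b + `|n|)%N => k kb.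
    by rewrite Dsingle tot_single db//; lia.
have [F FE] : exists F : pN -> dsum int X, forall f k,
    F f k = p (single (cl k) (tot (D k f))).
  apply: (@choice_fun pN (dsum int X) (fun f y => forall k,
    y k = p (single (cl k) (tot (D k f))))) => f.
  apply: (@mk_dsum X (fun k => p (single (cl k) (tot (D k f))))).
  have [b fb] := Dbnd f; exists b => k /fb ->.
  by rewrite (add0f (lsingle N (cl k)).1) (add0f pD).
have lF : lin F.
  apply: (lin_from_homog (g := g)) => [f h|j r f rj]; apply: dsumP => k.
    by rewrite dsumDE !FE DD [tot _]tD (lsingle N (cl k)).1 pD.
  transitivity ((r : R^c) *: F f k) => //.
  by rewrite !FE (Dact _ _ _ _ rj) [tot _]tZ (lsingle N (cl k)).2 pZ.
have [FD FZ] := lF.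
have Fneg f : f \in @pullup_neg R g N -> F f = 0.
  move=> /asboolP f0; apply: dsumP => k; rewrite FE Tsingle//.
  have [b Db] := dsum_bounded_window (D k f).
  rewrite (tot_window Db); apply: (ksub_sum (ksub_below k)) => i.
  rewrite DE; have [n0|n0] := leP 0 (- b%:Z + i%:Z).
    by rewrite f0// (add0f (gr_add gd _)); case: (ksub_below k).
  apply: sub_span; exists (- b%:Z + i%:Z + k); first lia.
  exact: gr_id gd _ _.
have FQ f : f \in generated (@pullup_neg R g N) -> F f = 0.
  move=> /generatedP fQ; apply/eqP; apply: (fQ (fun f => F f == 0)).
    apply/submod_ksub; have [z0 zB zZ] :=
      ksub_preim (lin_klin predT lF) (ksub0 predT (dsum int X)).
    split=> [|x y /eqP Fx /eqP Fy|a x aK /eqP Fx]; apply/eqP; first exact: z0.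
      exact: zB.
    exact: zZ.
  by move=> u /Fneg Fu; apply/eqP.
have [FP [lFP FPE]] := quo_descend lF FQ.
have [Psi PsiE] : exists Psi : int -> N -> pN, forall k y n,
    Psi k y n = d (n + k) y.
  suff: forall ky : int * N, exists h : pN, forall n, h n = d (n + ky.1) ky.2.
    by move=> /choice_fun[h hE]; exists (fun k f => h (k, f)) => k f n;
      rewrite hE.
  move=> [k y]; apply: (@mk_dsum N (fun n => d (n + k) y)).
  have [b db] := gr_bnd gd y; exists (b + `|k|)%N => n nb; apply: db; lia.
have lPsi k : lin (Psi k).
  apply: (lin_from_homog (g := g)) => [x y|j r x rj]; apply: dsumP => n.
    by rewrite dsumDE !PsiE (gr_add gd).
  by rewrite (pullup_act _ _ rj) !PsiE (gr_act_shift gd _ _ rj) addrAC.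
have Psi_homog k m x : d m x = x -> Psi k x = single (m - k) x.
  move=> dx; apply: dsumP => n; rewrite PsiE singleE -{1}dx (gr_orth gd).
  by rewrite (eq_sym n) subr_eq (eq_sym m); case: eqP => [->|].
have Psi_below k y : below k y -> q (Psi k y) = 0.
  apply: (span_min (U := [set y | q (Psi k y) = 0])).
    have lqP := lin_comp (quo_lin (@pullup_neg R g N)) (lPsi k).
    exact: (ksub_preim (lin_klin predT lqP) (ksub0 predT _)).
  move=> x [m mk dx] /=; rewrite (Psi_homog _ m)//; apply/quo_eq0.
  apply/generatedP => U _; apply; apply/asboolP => i i0; rewrite singleE.
  case: eqP => // iE; lia.
have [G GE] : exists G : int -> X -> pruefer g N, forall k,
    lin (G k) /\ forall h, G k (p h) = q (Psi k (h (cl k))).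
  apply: (@choice_fun int (X -> pruefer g N) (fun k Gk => lin Gk /\
    forall h, Gk (p h) = q (Psi k (h (cl k))))) => k.
  apply: (@quo_descend _ (dsum int N) T _ (fun h => q (Psi k (h (cl k))))).
    split=> [x y|a x]; first by rewrite dsumDE (lPsi k).1 qD.
    by rewrite (_ : (a *: x) (cl k) = a *: x (cl k))// (lPsi k).2 qZ.
  move=> h /genT/asboolP hT; apply: Psi_below; rewrite -clE; exact: hT.
have lG k : lin (G k) by exact: (GE k).1.
have [GG GGE] : exists GG : dsum int X -> dsum int (pruefer g N), forall y k,
    GG y k = G k (y k).
  apply: (@choice_fun (dsum int X) (dsum int (pruefer g N))
    (fun y z => forall k, z k = G k (y k))) => y.
  apply: (@mk_dsum (pruefer g N) (fun k => G k (y k))).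
  by have [b yb] := dsum_bounded y; exists b => k /yb ->; exact: add0f (lG k).1.
have lH : lin (fun y => tot (GG y)).
  split=> [x y|a x].
    rewrite -tot_add; congr tot; apply: dsumP => k.
    by rewrite dsumDE !GGE dsumDE (lG k).1.
  rewrite -tot_scale; congr tot; apply: dsumP => k.
  transitivity (a *: GG x k) => //; rewrite !GGE -(lG k).2//.
apply: (retract_finite_type flX lFP lH) => x.
have [f ->] := quo_surj x; rewrite FPE.
have HD u v : tot (GG (u + v)) = tot (GG u) + tot (GG v) by exact: lH.1.
pose fixed (f : pN) := tot (GG (F f)) = q f.
have fixedD u v : fixed u -> fixed v -> fixed (u + v).
  by move=> fu fv; rewrite /fixed FD HD fu fv qD.
have fixed0 : fixed 0 by rewrite /fixed (add0f FD) (add0f qD) (add0f lH.1).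
apply: (@dsum_ind N fixed f) => // n.
have [e eE] := mk_dsum (gr_bnd gd (f n)).
have <- : tot e = f n.
  apply: (gr_ext gd) => m; have [b eb] := dsum_bounded_window e.
  rewrite (tot_window eb) (add_sumf _ (gr_add gd m)).
  rewrite (eq_bigr (fun i : 'I_(b + b).+1 => if m == - b%:Z + i%:Z
    then e (- b%:Z + i%:Z) else 0)); last first.
    by move=> i _; rewrite eE (gr_orth gd); case: eqP => [->|].
  by rewrite sum_pick -eE; case: ifPn => // /eb.
apply: (@dsum_ind N (fun h => fixed (single n (tot h))) e).
- by rewrite (add0f (@tot_add N)) (add0f (@single_add N n)).
- by move=> h h' fh fh'; rewrite tot_add single_add; exact: fixedD.
move=> m; rewrite tot_single eE; set y := d m (f n).
have dy : d m y = y by exact: gr_id gd _ _.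
have -> : fixed (single n y) = (tot (GG (single (m - n)
    (p (single (cl (m - n)) y)))) = q (single n y)).
  congr (tot (GG _) = _); apply: dsumP => k.
  rewrite FE Dsingle tot_single -{1}dy (gr_orth gd) singleE.
  rewrite (eq_sym k) subr_eq (eq_sym m) (addrC k).
  case: eqP => [kE|_]; last by rewrite (add0f (lsingle N _).1) (add0f pD).
  by rewrite kE dy; congr (p (single (cl _) y)); lia.
have -> : GG (single (m - n) (p (single (cl (m - n)) y))) =
    single (m - n) (q (single n y)) :> dsum int (pruefer g N).
  apply: dsumP => k; rewrite GGE !singleE; case: eqP => [->|_].
    rewrite (GE _).2 singleE eqxx (Psi_homog _ m)//; congr (q (single _ y));
      lia.
  exact: add0f (lG k).1.
by rewrite tot_single.
Qed.

End GradedPruefer.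

Theorem proposition6p6 (R : pzRingType) (g : grading R) (N : lmodType R^c) :
  right_artinian R -> basic R -> finitely_generated N ->
  finite_type (pruefer g N) <-> gradable g N.
Proof.
move=> artR basicR fgN.
have flN := fg_finlen0 g artR basicR fgN.
split=> [ftP|/gradable_graded[d gd]].
  have [s gs] := grading_finite_support g artR basicR.
  by have [d] := pruefer_finite_type_graded gs flN ftP; exact: graded_gradable.
apply: graded_pruefer_finite_type gd.
by apply: finlen_weak flN.
Qed.
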